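(* Let $\mathbf f^{[\nu]}\in\mathcal C^3$ for $\nu=1,\dots,N$ and let $\mathbf A,\mathbf b,\mathbf c$ describe an explicit $2$-stage Runge--Kutta method of order two. Then the corresponding MPRK scheme (see context) is of order two if and only if, as $\Delta t\to0$, $$\pi_\nu^{(2)}=y_\nu^n+\mathcal O(\Delta t),\quad \nu=1,\dots,N,\qquad\text{and}\qquad \sigma_\mu=y_\mu^n+\Delta t\,f_\mu(\mathbf y^n)+\mathcal O(\Delta t^2),\quad\mu=1,\dots,N.$$
   Context: Conservative autonomous production-destruction system (PDS): $y_k'=\sum_{\nu=1}^N\bigl(p_{k\nu}(\mathbf y)-d_{k\nu}(\mathbf y)\bigr)$, $k=1,\dots,N$, with positive initial data, where $p_{k\nu},d_{k\nu}\ge0$ for $\mathbf y\ge\mathbf 0$, $p_{k\nu}=d_{\nu k}$ and $p_{kk}=d_{kk}=0$. It is written as $\mathbf y'=\mathbf f(\mathbf y)=\sum_{\nu=1}^N\mathbf f^{[\nu]}(\mathbf y)$ with $f^{[\nu]}_k=p_{k\nu}$ for $k\ne\nu$ and $f^{[k]}_k=-\sum_{\mu=1}^N d_{k\mu}$. Standing assumptions: each $\mathbf f^{[\nu]}$ is Lipschitz continuous; the Runge--Kutta coefficients satisfy $\mathbf A,\mathbf b\ge\mathbf 0$ and $\sum_{j}a_{ij}=c_i$. MPRK (modified Patankar--Runge--Kutta) scheme: for $k=1,\dots,N$, $$y_k^{(i)}=y_k^n+\Delta t\sum_{j=1}^{i-1}a_{ij}\sum_{\nu=1}^N\Bigl(p_{k\nu}(\mathbf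 y^{(j)})\frac{y_\nu^{(i)}}{\pi_\nu^{(i)}}-d_{k\nu}(\mathbf y^{(j)})\frac{y_k^{(i)}}{\pi_k^{(i)}}\Bigr),\ i=1,\dots,s,$$ $$y_k^{n+1}=y_k^n+\Delta t\sum_{j=1}^{s}b_{j}\sum_{\nu=1}^N\Bigl(p_{k\nu}(\mathbf y^{(j)})\frac{y_\nu^{n+1}}{\sigma_\nu}-d_{k\nu}(\mathbf y^{(j)})\frac{y_k^{n+1}}{\sigma_k}\Bigr),$$ here with $s=2$. The Patankar-weight denominators $\pi_\nu^{(i)}=\pi_\nu^{(i)}(\mathbf y^n,\mathbf y^{(1)},\dots,\mathbf y^{(i-1)})$ and $\sigma_\nu=\sigma_\nu(\mathbf y^n,\mathbf y^{(1)},\dots,\mathbf y^{(s)})$ are positive for every $\Delta t\ge0$, continuous, and independent of $\mathbf y^{(i)}$ and $\mathbf y^{n+1}$, respectively. Here $\mathbf y^n>\mathbf 0$. The expression $\mathbf y^n+\Delta t\,\mathbf f(\mathbf y^n)$ is the truncated NB-series $\mathrm{NB}_1(\tfrac1\gamma,\mathbf y^n)$ of the exact solution. Order: the method is of order $p$ if, starting from exact data $\mathbf y^n=\mathbf y(t_n)$, one step satisfies $\mathbf y^{n+1}-\mathbf y(t_n+\Delta t)=\mathcal O(\Delta t^{p+1})$ as $\Delta t\to0$. As usual for order conditions, the equivalence is understood for arbitrary right-hand sides of the stated class (elementary differentials regarded as linearly independent). *)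

(* Defs.v *)
From mathcomp Require Export all_boot all_order all_algebra.
From mathcomp Require Export all_classical all_reals all_analysis.
Set Implicit Arguments.
Unset Strict Implicit.
Unset Printing Implicit Defensive.
Import Order.TTheory GRing.Theory Num.Theory.
Import numFieldNormedType.Exports.
Local Open Scope classical_set_scope.
Local Open Scope ring_scope.

Definition pos_orthant (R : realType) (N : nat) : set 'rV[R]_N :=
  [set y | forall k, 0 < y 0 k].

Definition nneg_orthant (R : realType) (N : nat) : set 'rV[R]_N :=
  [set y | forall k, 0 <= y 0 k].

(* [Ck r D g], meant for open D: all iterated partial derivatives of g of order
   at most r exist and are continuous at every point of D. *)
Fixpoint Ck (R : realType) (N : nat) (r : nat) (D : set 'rV[R]_N)
    (g : 'rV[R]_N -> R) : Prop :=
  (forall x, D x -> {for x, continuous g}) /\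
  (if r is r'.+1 then
     forall i : 'I_N,
       (forall x, D x -> derivable g x (delta_mx 0 i)) /\
       Ck r' D (fun x => 'D_(delta_mx 0 i) g x)
   else True).

(* Forward solution only, so that t0 may be the initial time of the problem. *)
Definition ode_solution (R : realType) (N : nat) (f : 'rV[R]_N -> 'rV[R]_N)
    (t0 T : R) (y : R -> 'rV[R]_N) : Prop :=
  {within `[t0, t0 + T[, continuous y} /\
  (forall t, t0 < t -> t < t0 + T -> is_derive t 1 y (f (y t))).

(* [Phi h] is the result of one step of size h started at yn; the step has
   order q at yn if Phi h - y (tn + h) = O(h^(q+1)) as h -> 0+ for every solution
   y of y' = f(y) passing through yn at time tn. *)
Definition one_step_order (R : realType) (N : nat) (q : nat)
    (f : 'rV[R]_N -> 'rV[R]_N) (yn : 'rV[R]_N) (Phi : R -> 'rV[R]_N) : Prop :=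
  forall (tn T : R) (y : R -> 'rV[R]_N),
    0 < T -> ode_solution f tn T y -> y tn = yn ->
    (fun h : R => Phi h - y (tn + h)) =O_ (0^'+) (fun h : R => h ^+ q.+1).

Section RungeKutta.
Variables (R : realType) (s : nat) (A : 'M[R]_s) (b : 'rV[R]_s).

Definition rk_explicit : Prop :=
  forall i j : 'I_s, (i <= j)%N -> A i j = 0.

(* Stages Y and result yh of one step of size h for the autonomous y' = f(y). *)
Definition rk_step (N : nat) (f : 'rV[R]_N -> 'rV[R]_N) (h : R)
    (yn : 'rV[R]_N) (Y : 'I_s -> 'rV[R]_N) (yh : 'rV[R]_N) : Prop :=
  (forall i, Y i = yn + h *: \sum_j A i j *: f (Y j)) /\
  yh = yn + h *: \sum_j b 0 j *: f (Y j).

Definition rk_order (q : nat) : Prop :=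
  forall (N : nat) (f : 'rV[R]_N -> 'rV[R]_N),
    (forall k, Ck q.+1 setT (fun y => f y 0 k)) ->
    forall (yn : 'rV[R]_N) (Y : R -> 'I_s -> 'rV[R]_N) (Phi : R -> 'rV[R]_N),
      (forall h, 0 < h -> rk_step f h yn (Y h) (Phi h)) ->
      one_step_order q f yn Phi.

End RungeKutta.

Section PDS.
Variables (R : realType) (N : nat).
Implicit Types p d : 'I_N -> 'I_N -> 'rV[R]_N -> R.

Definition pds_rhs p d (y : 'rV[R]_N) : 'rV[R]_N :=
  \row_k \sum_nu (p k nu y - d k nu y).

(* The additive splitting f = \sum_nu f^[nu]. *)
Definition pds_split p d (nu : 'I_N) (y : 'rV[R]_N) : 'rV[R]_N :=
  \row_k (if k == nu then - \sum_mu d k mu y else p k nu y).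

Definition conservative_pds p d : Prop :=
  forall y, nneg_orthant y -> forall k nu,
    [/\ 0 <= p k nu y, 0 <= d k nu y, p k nu y = d nu k y,
        p k k y = 0 & d k k y = 0].

Definition pds_class (r : nat) p d : Prop :=
  [/\ conservative_pds p d,
      forall nu, [lipschitz pds_split p d nu y | y in @nneg_orthant R N] &
      forall nu k, Ck r (@pos_orthant R N) (fun y => pds_split p d nu y 0 k)].

End PDS.

Section MPRK.
Variables (R : realType) (N s : nat) (A : 'M[R]_s) (b : 'rV[R]_s).
Variables (p d : 'I_N -> 'I_N -> 'rV[R]_N -> R).

(* Patankar-weighted right-hand side: production and destruction terms are
   evaluated at y and weighted with the quotients z_nu / w_nu. *)
Definition patankar_rhs (y z w : 'rV[R]_N) : 'rV[R]_N :=
  \row_k \sum_nu (p k nu y * (z 0 nu / w 0 nu) - d k nu y * (z 0 k / w 0 k)).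

(* [w i] is the vector of the denominators pi^(i) of stage i. *)
Definition mprk_stages (h : R) (yn : 'rV[R]_N) (w Y : 'I_s -> 'rV[R]_N) : Prop :=
  forall i, Y i =
    yn + h *: \sum_(j < s | (j < i)%N) A i j *: patankar_rhs (Y j) (Y i) (w i).

(* [w] is the vector of the denominators sigma. *)
Definition mprk_update (h : R) (yn : 'rV[R]_N) (Y : 'I_s -> 'rV[R]_N)
    (w yh : 'rV[R]_N) : Prop :=
  yh = yn + h *: \sum_j b 0 j *: patankar_rhs (Y j) yh w.

End MPRK.

(* Two-stage schemes: stages 1 and 2 have the indices 0 and 1 of 'I_2.  The
   denominators are pi^(1)(y^n), pi^(2)(y^n, y^(1)) and
   sigma(y^n, y^(1), y^(2)), with the arguments grouped in tuples. *)
Section MPRK2.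
Variables (R : realType) (N : nat).
Variables (A : 'M[R]_2) (b : 'rV[R]_2).
Variables (pi1 : 'rV[R]_N -> 'rV[R]_N)
          (pi2 : 'rV[R]_N * 'rV[R]_N -> 'rV[R]_N)
          (sigma : 'rV[R]_N * 'rV[R]_N * 'rV[R]_N -> 'rV[R]_N).

Definition admissible_pwd : Prop :=
  [/\ forall x, pos_orthant x ->
        pos_orthant (pi1 x) /\ {for x, continuous pi1},
      forall x, pos_orthant x.1 -> pos_orthant x.2 ->
        pos_orthant (pi2 x) /\ {for x, continuous pi2} &
      forall x, pos_orthant x.1.1 -> pos_orthant x.1.2 -> pos_orthant x.2 ->
        pos_orthant (sigma x) /\ {for x, continuous sigma}].

Variables (p d : 'I_N -> 'I_N -> 'rV[R]_N -> R) (yn : 'rV[R]_N).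

Definition mprk2_stages (h : R) (Y : 'I_2 -> 'rV[R]_N) : Prop :=
  mprk_stages A p d h yn
    (fun i => if i == 0 then pi1 yn else pi2 (yn, Y 0)) Y.

Definition mprk2_step (h : R) (Y : 'I_2 -> 'rV[R]_N) (yh : 'rV[R]_N) : Prop :=
  mprk2_stages h Y /\ mprk_update b p d h yn Y (sigma (yn, Y 0, Y 1)) yh.

(* For yn > 0 and h >= 0 the linear systems defining the stages and the update
   are uniquely solvable (with positive solutions), so that quantifying over all
   families of solutions is the same as speaking about the MPRK step itself. *)
Definition mprk2_order (q : nat) : Prop :=
  forall (Y : R -> 'I_2 -> 'rV[R]_N) (Phi : R -> 'rV[R]_N),
    (forall h, 0 < h -> mprk2_step h (Y h) (Phi h)) ->
    one_step_order q (pds_rhs p d) yn Phi.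

Definition pwd_conditions : Prop :=
  forall Y : R -> 'I_2 -> 'rV[R]_N,
    (forall h, 0 < h -> mprk2_stages h (Y h)) ->
    (forall nu, (fun h : R => pi2 (yn, Y h 0) 0 nu - yn 0 nu)
                  =O_ (0^'+) (fun h : R => h)) /\
    (forall mu, (fun h : R => sigma (yn, Y h 0, Y h 1) 0 mu
                              - (yn 0 mu + h * pds_rhs p d yn 0 mu))
                  =O_ (0^'+) (fun h : R => h ^+ 2)).

End MPRK2.

(* Main.v *)
Require Import Defs.
From mathcomp Require Import ring lra.
Set Implicit Arguments.
Unset Strict Implicit.
Unset Printing Implicit Defensive.
Import Order.TTheory GRing.Theory Num.Theory.
Import numFieldNormedType.Exports.
Local Open Scope classical_set_scope.
Local Open Scope ring_scope.

(** Why the equivalence holds.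

    Write [P] for the matrix of the production terms at [yn] and [flux P x] for
    the balance [sum_nu (P k nu * x nu - P nu k * x k)], so that [flux P 1] is
    the right-hand side at [yn].  Since destruction mirrors production, the
    second stage [Z] and the update [Phi] solve linear systems
    [z = yn + h * flux M (z / w)].  Such a system has exactly one solution; it is
    positive and has the same total mass as [yn], hence is bounded uniformly in
    [h] ([patankar_sys_gt0], [patankar_sys_sum], [patankar_sys_exists]).  The
    first stage is [yn], so the denominators of the second stage are the constant
    vector [pi2 (yn, yn)], and the first condition says that it equals [yn].

    Sufficiency.  The order of the method forces [b_1 + b_2 = 1] and
    [b_2 a_21 = 1/2] ([rk2_order_conditions]).  If the ratios
    [Phi / sigma] are [1 + O(h^q)], then replacing them by [1] changes
    [Phi] by [O(h^(q+1))] only ([update_unweighted]).  The ratios are bounded at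
    first, and alternating this gain with the condition on [sigma] makes them
    [1 + O(h^2)]; so [Phi] agrees up to [O(h^3)] with a Runge-Kutta step, whose
    expansion is that of the exact solution ([mprk2_sufficient]).  Both expansions
    need only the second-order Taylor bound [Ck_taylor1] of the right-hand side at
    [yn]; the one of the exact solution follows by integrating the differential
    equation repeatedly ([ode_taylor2]).

    Necessity.  It suffices to test the method on production terms that are
    affine in one component.  A constant production matrix [P] has an affine exact
    solution, so order two says [flux P r = flux P 1 + O(h^2)] for the ratios
    [r = Phi / sigma] ([constant_step]).
    - A single transfer from [j] to [k] isolates [r_j], and [h -> 0] gives
      [sigma (yn, yn, yn) = yn] ([sigma_base]).
    - The production [y_j] and the constant production [yn_j] have the same
      second stage, hence the same denominators; comparing the second-order terms
      of the two exact solutions gives [pi2 (yn, yn) = yn] ([pi2_base]).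
    - For an arbitrary [P], the equation [flux P r = flux P 1 + O(h^2)] leaves the
      kernel of [flux P] undetermined.  Adding a multiple of [yn_i * yn_j] to the
      entries of [P] leaves [flux P 1] unchanged and the second stage traverses
      the same curve, with a new parameter [h' = h / (1 - h)].  The denominators
      depend on the stages alone, so the two balances hold for the same [sigma],
      and their difference forces all ratios to agree up to [O(h^2)].  The
      original balance then makes the common value [1 + O(h^2)], unless
      [flux P 1 = 0]; but in that case [Z = yn], where [sigma] is already known
      ([pwd_necessary]). *)

(** * Orders of vanishing at 0 from the right *)

Section OrderCalculus.
Variable R : realType.

Lemma near_right0P (P : R -> Prop) :
  (\forall h \near 0^'+, P h) <->
  exists2 d : R, 0 < d & forall h, 0 < h -> h < d -> P h.
Proof.
split.
  move=> /nbhs_ballP[d /= d0 dP]; exists d => // h h0 hd.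
  by apply: dP => //; rewrite /ball/= sub0r normrN gtr0_norm.
move=> [d d0 dP]; near=> h; apply: dP; near: h.
  exact: nbhs_right_gt.
exact: nbhs_right_lt.
Unshelve. all: by end_near. Qed.

(** The constant is explicit and of either sign, which keeps the rules below free
    of side conditions; [isO_bigO] relates the notion to the Landau notation. *)
Definition isO (V : normedModType R) (q : nat) (u : R -> V) : Prop :=
  exists C : R, \forall h \near 0^'+, `|u h| <= C * h ^+ q.

Lemma isO_bigO (V : normedModType R) q (u : R -> V) :
  isO q u <-> u =O_ (0^'+) (fun h : R => h ^+ q).
Proof.
split=> [[C hC]|/eqO_exP[C C0 hC]].
  apply/eqO_exP; exists (Num.max C 1); first by rewrite lt_max ltr01 orbT.
  near=> h; have h0 : 0 < h by near: h; exact: nbhs_right_gt.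
  apply: (@le_trans _ _ (C * h ^+ q)); first by near: h.
  rewrite [`|h ^+ q|]ger0_norm ?exprn_ge0 ?(ltW h0)//.
  by rewrite ler_wpM2r ?exprn_ge0 ?(ltW h0)// le_max lexx.
exists C; near=> h; have h0 : 0 < h by near: h; exact: nbhs_right_gt.
have : `|u h| <= C * `|h ^+ q| by near: h.
by rewrite (ger0_norm (exprn_ge0 _ (ltW h0))).
Unshelve. all: by end_near. Qed.

(** Products of bounds are bounds only for nonnegative constants. *)
Lemma isO_ge0 (V : normedModType R) q (u : R -> V) : isO q u ->
  exists2 C : R, 0 <= C & \forall h \near 0^'+, `|u h| <= C * h ^+ q.
Proof.
move=> [C hC]; exists (Num.max C 0); first by rewrite le_max lexx orbT.
near=> h; have h0 : 0 < h by near: h; exact: nbhs_right_gt.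
have /le_trans -> // : `|u h| <= C * h ^+ q by near: h.
by rewrite ler_wpM2r ?exprn_ge0 ?(ltW h0)// le_max lexx.
Unshelve. all: by end_near. Qed.

Lemma isO_eq_near (V : normedModType R) q (u v : R -> V) :
  (\forall h \near 0^'+, u h = v h) -> isO q u -> isO q v.
Proof.
move=> uv [C hC]; exists C; near=> h.
have <- : u h = v h by near: h.
by near: h.
Unshelve. all: by end_near. Qed.

Lemma isO_eq (V : normedModType R) q (u v : R -> V) :
  (forall h, 0 < h -> u h = v h) -> isO q u -> isO q v.
Proof.
move=> uv; apply: isO_eq_near; near=> h; apply: uv.
by near: h; exact: nbhs_right_gt.
Unshelve. all: by end_near. Qed.

Lemma isOD (V : normedModType R) q (u v : R -> V) :
  isO q u -> isO q v -> isO q (fun h => u h + v h).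
Proof.
move=> [C hC] [D hD]; exists (C + D); near=> h.
rewrite mulrDl (le_trans (ler_normD _ _))// lerD//.
  by near: h.
by near: h.
Unshelve. all: by end_near. Qed.

Lemma isON (V : normedModType R) q (u : R -> V) :
  isO q u -> isO q (fun h => - u h).
Proof. by move=> [C hC]; exists C; near=> h; rewrite normrN; near: h.
Unshelve. all: by end_near. Qed.

Lemma isOB (V : normedModType R) q (u v : R -> V) :
  isO q u -> isO q v -> isO q (fun h => u h - v h).
Proof. by move=> hu /isON; exact: isOD. Qed.

Lemma isO0 (V : normedModType R) q : isO q (fun=> 0 : V).
Proof. by exists 0; apply: nearW => h; rewrite normr0 mul0r. Qed.

Lemma isO_sum (V : normedModType R) (I : finType) q (u : I -> R -> V) :
  (forall i, isO q (u i)) -> isO q (fun h => \sum_i u i h).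
Proof.
move=> hu; elim: (index_enum I) => [|i s IHs].
  by apply: (isO_eq _ (@isO0 V q)) => h _; rewrite big_nil.
by apply: (isO_eq _ (isOD (hu i) IHs)) => h _; rewrite big_cons.
Qed.

Lemma isOM a b (u v : R -> R) :
  isO a u -> isO b v -> isO (a + b) (fun h => u h * v h).
Proof.
move=> /isO_ge0[C C0 hC] /isO_ge0[D D0 hD]; exists (C * D); near=> h.
rewrite normrM exprD mulrACA ler_pM//; by near: h.
Unshelve. all: by end_near. Qed.

Lemma isOW (V : normedModType R) a b (u : R -> V) :
  (a <= b)%N -> isO b u -> isO a u.
Proof.
move=> ab /isO_ge0[C C0 hC]; exists C; near=> h.
have h0 : 0 < h by near: h; exact: nbhs_right_gt.
have h1 : h <= 1 by near: h; exact: nbhs_right_le.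
have /le_trans -> // : `|u h| <= C * h ^+ b by near: h.
by rewrite ler_wpM2l// ler_wiXn2l// ltW.
Unshelve. all: by end_near. Qed.

Lemma isO_cst (V : normedModType R) (c : V) : isO 0 (fun=> c).
Proof. by exists `|c|; apply: nearW => h; rewrite mulr1. Qed.

Lemma isO_id : isO 1 (fun h : R => h).
Proof.
exists 1; near=> h; have h0 : 0 < h by near: h; exact: nbhs_right_gt.
by rewrite mul1r expr1 gtr0_norm.
Unshelve. all: by end_near. Qed.

Lemma isOMl q c (u : R -> R) : isO q u -> isO q (fun h => c * u h).
Proof. exact: isOM (isO_cst c). Qed.

Lemma isO_hM q (u : R -> R) : isO q u -> isO q.+1 (fun h => h * u h).
Proof. exact: isOM isO_id. Qed.

Lemma isO_divh q (u : R -> R) : isO q.+1 (fun h => h * u h) -> isO q u.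
Proof.
move=> [C hC]; exists C; near=> h.
have h0 : 0 < h by near: h; exact: nbhs_right_gt.
rewrite -(ler_pM2l h0) mulrCA -exprS -[X in X * _](gtr0_norm h0) -normrM.
by near: h.
Unshelve. all: by end_near. Qed.

Lemma isO_bounded C (u : R -> R) :
  (forall h, 0 < h -> `|u h| <= C) -> isO 0 u.
Proof.
move=> uC; exists C; near=> h; have h0 : 0 < h by near: h; exact: nbhs_right_gt.
by rewrite mulr1 uC.
Unshelve. all: by end_near. Qed.

Lemma isO_cvg0 (V : normedModType R) q (u : R -> V) :
  isO q.+1 u -> u h @[h --> 0^'+] --> (0 : V).
Proof.
move=> /(isOW (isT : (1 <= q.+1)%N)) /isO_ge0[C C0 hC].
apply/cvgr0Pnorm_lt => e e0; near=> h.
have /le_lt_trans -> // : `|u h| <= C * h ^+ 1 by near: h.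
have h0 : 0 < h by near: h; exact: nbhs_right_gt.
have he : h < e / (C + 1).
  by near: h; apply: nbhs_right_lt; rewrite divr_gt0// ltr_wpDl.
rewrite expr1 (@le_lt_trans _ _ ((C + 1) * h))//.
  by rewrite ler_wpM2r ?(ltW h0)// lerDl.
by rewrite mulrC -ltr_pdivlMr// ltr_wpDl.
Unshelve. all: by end_near. Qed.

Lemma cvg_isO0 (V : normedModType R) (u : R -> V) (l : V) :
  u h @[h --> 0^'+] --> l -> isO 0 u.
Proof.
move=> ul; exists (`|l| + 1); near=> h; rewrite mulr1.
have /ltW : `|l - u h| < 1 by near: h; move/cvgrPdist_lt : ul; exact.
by rewrite distrC => ?; rewrite -[u h](subrK l) addrC (le_trans (ler_normD _ _))// lerD2l.
Unshelve. all: by end_near. Qed.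

(** This is how a condition on a quantity independent of [h] becomes an
    equation. *)
Lemma isO_cst_eq0 q (c : R) : isO q.+1 (fun=> c) -> c = 0.
Proof.
move=> /isO_cvg0 c0; have := cvg_unique _ c0 (cvg_cst c).
by move=> <-.
Qed.

Lemma ler_mxnorm N (u : 'rV[R]_N) i : `|u 0 i| <= `|u|.
Proof.
rewrite [leRHS]/Num.Def.normr/= mx_normrE.
exact: (le_bigmax _ (fun ij => `|u ij.1 ij.2|) (0, i)).
Qed.

Lemma mxnorm_le N (u : 'rV[R]_N) C :
  0 <= C -> (forall i, `|u 0 i| <= C) -> `|u| <= C.
Proof.
move=> C0 uC; rewrite [leLHS]/Num.Def.normr/= mx_normrE bigmax_le// => -[i j] _ /=.
by rewrite ord1.
Qed.

Lemma isO_rVP N q (u : R -> 'rV[R]_N) :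
  isO q u <-> forall i, isO q (fun h => u h 0 i).
Proof.
split=> [[C hC] i|hu].
  exists C; near=> h; apply: le_trans (ler_mxnorm _ _) _.
  by near: h.
have /cid[C hC] : exists C : 'I_N -> R, forall i,
    0 <= C i /\ \forall h \near 0^'+, `|u h 0 i| <= C i * h ^+ q.
  have h i : exists D : R, 0 <= D /\ \forall h \near 0^'+, `|u h 0 i| <= D * h ^+ q.
    by have /isO_ge0[D] := hu i; exists D.
  by exists (fun i => sval (cid (h i))) => i; case: (cid (h i)).
exists (\sum_i C i); near=> h.
have h0 : 0 < h by near: h; exact: nbhs_right_gt.
apply: mxnorm_le => [|i].
  by rewrite mulr_ge0 ?exprn_ge0 ?(ltW h0)// sumr_ge0// => i _; case: (hC i).
apply: (@le_trans _ _ (C i * h ^+ q)).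
  by move: i; near: h; apply: filter_forall => i; exact: (hC i).2.
rewrite ler_wpM2r ?exprn_ge0 ?(ltW h0)// (bigD1 i)//= lerDl.
by rewrite sumr_ge0// => j _; case: (hC j).
Unshelve. all: by end_near. Qed.

End OrderCalculus.
(** * Patankar systems *)

Section PatankarSystem.
Variables (R : realType) (N : nat).
Implicit Types (M : 'I_N -> 'I_N -> R) (x : 'I_N -> R).

(** The matrix [M] collects production terms.  The weighted right-hand side of
    the scheme is obtained for [x] the vector of Patankar ratios, the right-hand
    side of the differential equation for [x = 1]. *)
Definition flux M x (k : 'I_N) : R := \sum_nu (M k nu * x nu - M nu k * x k).

(** Summation by parts.  The weights [s = 1] give conservation, the indicator of
    the negative components gives positivity. *)
Lemma flux_sum M x (s : 'I_N -> R) :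
  \sum_k s k * flux M x k = \sum_k \sum_nu M k nu * x nu * (s k - s nu).
Proof.
under eq_bigr do rewrite /flux mulr_sumr.
under eq_bigr do under eq_bigr do rewrite mulrBr.
under eq_bigr do rewrite sumrB.
rewrite sumrB [X in _ - X]exchange_big -sumrB; apply: eq_bigr => k _.
by rewrite -sumrB; apply: eq_bigr => nu _; ring.
Qed.

Lemma flux_conservative M x : \sum_k flux M x k = 0.
Proof.
have := flux_sum M x (fun=> 1); under eq_bigr do rewrite mul1r.
by move=> ->; rewrite big1// => k _; rewrite big1// => nu _; rewrite subrr mulr0.
Qed.

Lemma fluxDl M M' x k :
  flux (fun i j => M i j + M' i j) x k = flux M x k + flux M' x k.
Proof. by rewrite -big_split; apply: eq_bigr => nu _ /=; ring. Qed.

Lemma fluxZl c M x k : flux (fun i j => c * M i j) x k = c * flux M x k.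
Proof. by rewrite mulr_sumr; apply: eq_bigr => nu _ /=; ring. Qed.

Lemma fluxBr M x y k :
  flux M (fun i => x i - y i) k = flux M x k - flux M y k.
Proof. by rewrite -sumrB; apply: eq_bigr => nu _ /=; ring. Qed.

Lemma fluxZr c M x k : flux M (fun i => c * x i) k = c * flux M x k.
Proof. by rewrite mulr_sumr; apply: eq_bigr => nu _ /=; ring. Qed.

Lemma eq_flux M M' x x' k :
  (forall i j, M i j = M' i j) -> x =1 x' -> flux M x k = flux M' x' k.
Proof.
by move=> MM' xx'; apply: eq_bigr => nu _; rewrite !MM' !xx'.
Qed.

Definition patankar_sys (h : R) M (y w z : 'rV[R]_N) : Prop :=
  forall k, z 0 k = y 0 k + h * flux M (fun i => z 0 i / w 0 i) k.

Section Solutions.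
Variables (h : R) (M : 'I_N -> 'I_N -> R) (w : 'rV[R]_N).
Hypotheses (h0 : 0 <= h) (M0 : forall i j, 0 <= M i j) (w0 : pos_orthant w).

Lemma patankar_sys_sum y z : patankar_sys h M y w z ->
  \sum_k z 0 k = \sum_k y 0 k.
Proof.
move=> zE; rewrite (eq_bigr _ (fun k _ => zE k)) big_split/= -mulr_sumr.
by rewrite flux_conservative mulr0 addr0.
Qed.

(** If the components of [z] on a set [s] are negative and the others are not,
    then mass flows into [s] only, so the total mass on [s] is at least that of
    [y].  This contradicts negativity unless [s] is empty. *)
Lemma patankar_sys_ge0 y z :
  patankar_sys h M y w z -> nneg_orthant y -> nneg_orthant z.
Proof.
move=> zE y0 k0; rewrite leNgt; apply/negP => zk0.
pose s k : R := (z 0 k < 0)%R%:R.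
have : \sum_k s k * z 0 k < 0.
  rewrite (bigD1 k0)//= {1}/s zk0 mul1r ltr_wnDr//.
  rewrite sumr_le0// => k _; rewrite /s.
  by case: ltP => [/ltW|]; rewrite ?mul1r ?mul0r.
apply/negP; rewrite -leNgt.
have -> : \sum_k s k * z 0 k =
    \sum_k s k * y 0 k + h * \sum_k s k * flux M (fun i => z 0 i / w 0 i) k.
  rewrite mulr_sumr -big_split/=; apply: eq_bigr => k _.
  by rewrite {1}(zE k); ring.
rewrite addr_ge0//; first by rewrite sumr_ge0// => k _; rewrite mulr_ge0// ler0n.
rewrite mulr_ge0// flux_sum sumr_ge0// => k _; rewrite sumr_ge0// => nu _.
rewrite -mulrA mulr_ge0// /s.
have wV : 0 < (w 0 nu)^-1 by rewrite invr_gt0.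
case: (ltP (z 0 nu) 0) => znu; case: ltP => _; rewrite ?subrr ?mulr0//.
  by rewrite sub0r mulrN1 oppr_ge0 mulr_le0_ge0 ?ltW.
by rewrite subr0 mulr1 mulr_ge0// ltW.
Qed.

(** A vanishing component loses no mass, so it would be at least that of [y]. *)
Lemma patankar_sys_gt0 y z :
  patankar_sys h M y w z -> pos_orthant y -> pos_orthant z.
Proof.
move=> zE y0.
have z0 : nneg_orthant z by apply: patankar_sys_ge0 zE _ => k; exact/ltW/y0.
move=> k; rewrite lt_neqAle z0 andbT; apply/eqP => zk.
have := zE k; rewrite -zk => /eqP; rewrite eq_sym gt_eqF// ltr_pwDl//.
rewrite mulr_ge0// sumr_ge0// => nu _; rewrite -zk mul0r mulr0 subr0.
by rewrite mulr_ge0// divr_ge0// ltW.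
Qed.

Lemma patankar_sys_le y z k :
  patankar_sys h M y w z -> pos_orthant y -> `|z 0 k| <= \sum_i y 0 i.
Proof.
move=> zE y0; have z0 := patankar_sys_gt0 zE y0.
rewrite gtr0_norm// -(patankar_sys_sum zE) (bigD1 k)//= lerDl.
by rewrite sumr_ge0// => i _; exact/ltW/z0.
Qed.

(** Linearity reduces uniqueness to nonnegativity: the difference of two
    solutions and its opposite both solve the system with [y = 0]. *)
Lemma patankar_sys_uniq y z z' :
  patankar_sys h M y w z -> patankar_sys h M y w z' -> z = z'.
Proof.
have hom (u v : 'rV[R]_N) : patankar_sys h M y w u -> patankar_sys h M y w v ->
    forall k, 0 <= (u - v) 0 k.
  move=> uE vE; apply: (@patankar_sys_ge0 0) => [k|k]; last by rewrite mxE.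
  rewrite !mxE add0r uE vE opprD addrACA subrr add0r -mulrBr -fluxBr.
  by congr (_ * _); apply: eq_flux => // i; rewrite !mxE mulrBl.
move=> zE z'E; apply/rowP => k; apply/eqP; rewrite eq_le.
have := hom _ _ zE z'E k; have := hom _ _ z'E zE k.
by rewrite !mxE !subr_ge0 => -> ->.
Qed.

(** The system is square and linear, so existence follows from uniqueness. *)
Lemma patankar_sys_exists y : exists z, patankar_sys h M y w z.
Proof.
(* Row vectors act from the left, so row [i] of [B] holds the image of the
   [i]-th unit vector. *)
pose B : 'M[R]_N := \matrix_(i, k)
  ((i == k)%:R - h * flux M (fun j => (i == j)%:R / w 0 j) k).
have BE (z : 'rV[R]_N) k :
    (z *m B) 0 k = z 0 k - h * flux M (fun i => z 0 i / w 0 i) k.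
  rewrite mxE; under eq_bigr do rewrite mxE mulrBr mulrCA.
  rewrite sumrB -mulr_sumr; congr (_ - _ * _).
    rewrite (bigD1 k)//= eqxx mulr1 big1 ?addr0// => i /negPf ->.
    by rewrite mulr0.
  under eq_bigr do rewrite -fluxZr.
  have -> : \sum_i flux M (fun i0 => z 0 i * ((i == i0)%:R / w 0 i0)) k =
     flux M (fun j => \sum_i z 0 i * ((i == j)%:R / w 0 j)) k.
    rewrite /flux exchange_big/=; apply: eq_bigr => nu _.
    by rewrite sumrB -!mulr_sumr.
  apply: eq_flux => // j; rewrite (bigD1 j)//= eqxx mul1r big1 ?addr0//.
  by move=> i /negPf ->; rewrite mul0r mulr0.
have : B \in unitmx.
  rewrite -row_free_unit; apply: inj_row_free => v vB.
  have vE : patankar_sys h M 0 w v.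
    move=> k; have := BE v k; rewrite vB !mxE => /eqP.
    by rewrite eq_sym subr_eq0 add0r => /eqP.
  apply: (patankar_sys_uniq vE) => k; rewrite !mxE add0r.
  rewrite (@eq_flux _ M _ (fun=> 0 * 0))// => [|i]; last by rewrite mxE mul0r mulr0.
  by rewrite fluxZr mul0r mulr0.
move=> Bu; exists (y *m invmx B) => k.
by have := BE (y *m invmx B) k; rewrite mulmxKV// => ->; rewrite subrK.
Qed.

End Solutions.
End PatankarSystem.
(** * Taylor bounds from partial derivatives *)

Section Calculus.
Variable R : realType.

Lemma is_derive_coord (V : normedModType R) m n (M : V -> 'M[R]_(m, n))
    (t v : V) (l : 'M[R]_(m, n)) i j :
  is_derive t v M l -> is_derive t v (fun s => M s i j) (l i j).
Proof.
case=> dM <-; apply: DeriveDef; first exact: (derivable_mxP _ _ _).1.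
by rewrite derive_mx// mxE.
Qed.

Lemma is_derive_affine N (x v : 'rV[R]_N) (a b : R) i :
  is_derive x v (fun y : 'rV[R]_N => a + b * y 0 i) (b * v 0 i).
Proof.
rewrite -[b * v 0 i]add0r; apply: is_deriveD.
apply: (@is_deriveZ _ _ _ (fun y : 'rV[R]_N => y 0 i) b).
exact: (@is_derive_coord _ _ _ id).
Qed.

Lemma Ck_affine N r (D : set 'rV[R]_N) (a b : R) i :
  Ck r D (fun y => a + b * y 0 i).
Proof.
have cont a' b' (x : 'rV[R]_N) :
    {for x, continuous (fun y : 'rV[R]_N => a' + b' * y 0 i)}.
  exact: (cvgD (cvg_cst a') (cvgM (cvg_cst b') (@coord_continuous R 1 N 0 i x))).
elim: r a b => [|r IHr] a b; split=> //.
move=> j; split=> [x _|]; first by case: (is_derive_affine x (delta_mx 0 j) a b i).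
have -> : (fun x => 'D_(delta_mx 0 j) (fun y : 'rV[R]_N => a + b * y 0 i) x) =
    (fun x : 'rV[R]_N => b * (delta_mx 0 j : 'rV[R]_N) 0 i + 0 * x 0 i).
  apply/funext => x; rewrite mul0r addr0.
  by case: (is_derive_affine x (delta_mx 0 j) a b i).
exact: IHr.
Qed.

Lemma is_derive_line N (g : 'rV[R]_N -> R) (x v : 'rV[R]_N) (t l : R) :
  is_derive (x + t *: v) v g l -> is_derive t 1 (fun s => g (x + s *: v)) l.
Proof.
have E : (fun h => h^-1 *: (g (h *: v + (x + t *: v)) - g (x + t *: v))) =
         (fun h => h^-1 *: (g (x + (h *: 1 + t) *: v) - g (x + t *: v))).
  by apply/funext => h; rewrite [h *: 1]mulr1 scalerDl addrCA.
case=> [dg gl]; apply: DeriveDef; first by rewrite /derivable -E.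
by rewrite -gl /derive -E.
Qed.

Lemma line_increment (phi dphi : R -> R) (s C : R) :
  (forall t : R, `|t| <= `|s| -> is_derive t 1 phi (dphi t) /\ `|dphi t| <= C) ->
  `|phi s - phi 0| <= C * `|s|.
Proof.
move=> H.
have cont a b : (forall t, t \in `[a, b] -> `|t| <= `|s|) ->
    {within `[a, b], continuous phi}.
  move=> ab; apply: derivable_within_continuous => t /ab /H[[]].
  by [].
have [s0|s0|->] := ltgtP s 0; last by rewrite subrr !normr0 mulr0.
- have ab t : t \in `[s, 0] -> `|t| <= `|s|.
    by rewrite in_itv/= => /andP[st t0]; rewrite !ler0_norm ?lerN2 ?(ltW s0).
  have [c cab E] := MVT s0 (fun x xI => (H x (ab x (subset_itv_oo_cc xI))).1)
                        (cont _ _ ab).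
  rewrite distrC E normrM sub0r normrN ler_wpM2r//.
  exact: (H c (ab c (subset_itv_oo_cc cab))).2.
- have ab t : t \in `[0, s] -> `|t| <= `|s|.
    by rewrite in_itv/= => /andP[t0 ts]; rewrite !ger0_norm ?(ltW s0).
  have [c cab E] := MVT s0 (fun x xI => (H x (ab x (subset_itv_oo_cc xI))).1)
                        (cont _ _ ab).
  rewrite E normrM subr0 ler_wpM2r//.
  exact: (H c (ab c (subset_itv_oo_cc cab))).2.
Qed.

(** Only partial derivatives are at hand, so the increment from [y0] to [z] is
    split into steps parallel to the axes.  All intermediate points stay in the
    closed ball of the supremum norm around [y0] that has [z] on its boundary. *)
Lemma partial_increment N (g : 'rV[R]_N -> R) (D : 'I_N -> 'rV[R]_N -> R)
    (y0 z : 'rV[R]_N) (C : R) :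
  (forall x i, `|x - y0| <= `|z - y0| ->
     is_derive x (delta_mx 0 i) g (D i x) /\ `|D i x| <= C) ->
  `|g z - g y0| <= N%:R * C * `|z - y0|.
Proof.
move=> H.
pose path m : 'rV[R]_N := \row_i (if (i < m)%N then z 0 i else y0 0 i).
have -> : g z - g y0 = \sum_(m < N) (g (path m.+1) - g (path m)).
  rewrite -(big_mkord xpredT (fun m => g (path m.+1) - g (path m))).
  rewrite telescope_sumr//; congr (g _ - g _); apply/rowP => i; rewrite mxE//.
  by rewrite ltn_ord.
rewrite (le_trans (ler_norm_sum _ _ _))//.
rewrite -mulrA mulr_natl -[X in _ *+ X](card_ord N) -sumr_const ler_sum// => m _.
pose s := z 0 m - y0 0 m.
have pathS : path m.+1 = path m + s *: delta_mx 0 m.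
  apply/rowP => i; rewrite !mxE/= eq_sym ltnS leq_eqVlt; have [->|im] := eqVneq i m.
    by rewrite eqxx ltnn /= mulr1 /s addrC subrK.
  by rewrite -val_eqE/= in im; rewrite (negPf im)/= mulr0 addr0.
have zs : `|s| <= `|z - y0| by have := ler_mxnorm (z - y0) m; rewrite !mxE.
rewrite pathS -[X in g _ - g X]addr0 -(scale0r (delta_mx 0 m)).
apply: (@le_trans _ _ (C * `|s|)); last first.
  rewrite ler_wpM2l//; apply: le_trans (H y0 m _).2 => //.
  by rewrite subrr normr0.
apply: (@line_increment (fun t => g (path m + t *: delta_mx 0 m))
   (fun t => D m (path m + t *: delta_mx 0 m))) => t ts.
suff /(H _ m)[? ?] : `|path m + t *: delta_mx 0 m - y0| <= `|z - y0|.
  by split=> //; exact: is_derive_line.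
apply: mxnorm_le => // i; rewrite !mxE/=; have [->|im] := eqVneq i m.
  by rewrite ltnn mulr1 addrAC subrr add0r (le_trans ts).
rewrite mulr0 addr0; case: ifP => _; last by rewrite subrr normr0.
by have := ler_mxnorm (z - y0) i; rewrite !mxE.
Qed.

Definition taylor1 N (g : 'rV[R]_N -> R) (y0 : 'rV[R]_N) (J : 'I_N -> R) :=
  exists C : R, \forall z \near y0,
    `|g z - g y0 - \sum_i J i * (z 0 i - y0 0 i)| <= C * `|z - y0| ^+ 2.

(** The increment bound is used twice: for the partial derivatives of [g], which
    are Lipschitz at [y0] because the second ones are bounded near [y0], and for
    [g] minus its linear part, whose partial derivatives are differences of
    these. *)
Lemma Ck_taylor1 N r (D : set 'rV[R]_N) (g : 'rV[R]_N -> R) y0 :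
  open D -> D y0 -> Ck r.+2 D g -> exists J, taylor1 g y0 J.
Proof.
move=> oD Dy0 [_ Hg].
pose g1 i := 'D_(delta_mx 0 i) g; pose g2 i j := 'D_(delta_mx 0 j) (g1 i).
have dg i x : D x -> is_derive x (delta_mx 0 i) g (g1 i x).
  by move=> Dx; apply/derivableP; exact: (Hg i).1.
have dg1 i j x : D x -> is_derive x (delta_mx 0 j) (g1 i) (g2 i j x).
  by move=> Dx; apply/derivableP; exact: ((Hg i).2.2 j).1.
have cg2 i j : {for y0, continuous (g2 i j)}.
  case: ((Hg i).2.2 j) => _; case: r {Hg} => [|r] [+ _]; exact.
clearbody g2; clearbody g1; clear Hg.
pose C := \sum_i \sum_j (`|g2 i j y0| + 1).
have [rho rho0 rhoP] : exists2 rho : R, 0 < rho & forall x, `|x - y0| < rho ->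
    D x /\ forall i j, `|g2 i j x| <= C.
  have : \forall x \near y0, D x /\ forall i j, `|g2 i j x| <= C.
    near=> x; split; first by near: x; exact: open_nbhs_nbhs.
    move=> i j; apply: (@le_trans _ _ (`|g2 i j y0| + 1)).
      have : `|g2 i j y0 - g2 i j x| <= 1.
        move: i j; near: x; apply: filter_forall => i; apply: filter_forall => j.
        by have /cvgrPdist_le := cg2 i j; exact.
      move=> le1; rewrite -[g2 i j x](subrK (g2 i j y0)) addrC.
      by rewrite (le_trans (ler_normD _ _))// lerD2l distrC.
    rewrite /C (bigD1 i)//= (bigD1 j)//= -!addrA lerD2l lerDl.
    apply: addr_ge0; first by apply: sumr_ge0 => k _; rewrite addr_ge0.
    by apply: sumr_ge0 => k _; apply: sumr_ge0 => l _; rewrite addr_ge0.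
  move=> /nbhs_ballP[rho /= rho0 hrho]; exists rho => // x xy; apply: hrho.
  by rewrite -ball_normE /ball_/= distrC.
have lip1 i z : `|z - y0| < rho -> `|g1 i z - g1 i y0| <= N%:R * C * `|z - y0|.
  move=> zr; apply: (@partial_increment _ _ (g2 i)) => x j xz.
  have [Dx cx] := rhoP x (le_lt_trans xz zr).
  by split; [exact: dg1|exact: cx].
exists (fun i => g1 i y0); exists (N%:R * (N%:R * C)).
apply/nbhs_ballP; exists rho => //= z; rewrite -ball_normE /ball_/= distrC => zr.
pose u x := g x - \sum_i g1 i y0 * x 0 i.
have -> : g z - g y0 - \sum_i g1 i y0 * (z 0 i - y0 0 i) = u z - u y0.
  rewrite /u (eq_bigr (fun i => g1 i y0 * z 0 i - g1 i y0 * y0 0 i)).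
    by rewrite sumrB; ring.
  by move=> i _; rewrite mulrBr.
have -> : N%:R * (N%:R * C) * `|z - y0| ^+ 2 =
    N%:R * (N%:R * C * `|z - y0|) * `|z - y0| by ring.
apply: (@partial_increment _ u (fun i x => g1 i x - g1 i y0)) => x i xz.
have xr := le_lt_trans xz zr.
split; last first.
  apply: le_trans (lip1 i x xr) _; rewrite ler_wpM2l// mulr_ge0//.
  by rewrite sumr_ge0// => k _; rewrite sumr_ge0// => l _; rewrite addr_ge0.
apply: is_deriveB; first by apply: dg; exact: (rhoP x xr).1.
have -> : (fun x0 : 'rV[R]_N => \sum_i0 g1 i0 y0 * x0 0 i0) =
          \sum_i0 (fun x0 : 'rV[R]_N => g1 i0 y0 * x0 0 i0).
  by apply/funext => x0; rewrite fct_sumE.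
have -> : g1 i y0 = \sum_j g1 j y0 * (j == i)%:R.
  rewrite (bigD1 i)//= eqxx mulr1 big1 ?addr0// => j /negPf ->.
  by rewrite mulr0.
apply: is_derive_sum => j.
have := @is_derive_affine _ x (delta_mx 0 i) 0 (g1 j y0) j.
by rewrite !mxE/=; under eq_fun do rewrite add0r.
Unshelve. all: by end_near. Qed.

End Calculus.
(** * Second-order expansion of exact solutions *)

Section OdeExpansion.
Variable R : realType.

Lemma taylor1_along N (g : 'rV[R]_N -> R) y0 J (u : R -> 'rV[R]_N) q :
  taylor1 g y0 J -> u h @[h --> 0^'+] --> y0 -> isO q (fun h => u h - y0) ->
  isO (q + q) (fun h => g (u h) - g y0 - \sum_i J i * (u h 0 i - y0 0 i)).
Proof.
move=> [C gC] uy0 /isO_ge0[D D0 uD]; exists (Num.max C 0 * D ^+ 2); near=> h.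
apply: (@le_trans _ _ (C * `|u h - y0| ^+ 2)).
  by near: h; exact: (uy0 _ gC).
apply: (@le_trans _ _ (Num.max C 0 * `|u h - y0| ^+ 2)).
  by rewrite ler_wpM2r ?exprn_ge0// le_max lexx.
rewrite -mulrA ler_wpM2l ?le_max ?lexx ?orbT// exprD -expr2 -exprMn.
have uh : `|u h - y0| <= D * h ^+ q by near: h.
by rewrite lerXn2r ?nnegrE// (le_trans (normr_ge0 _) uh).
Unshelve. all: by end_near. Qed.

(** The mean value theorem replaces the integral of [u'], which is only known
    pointwise. *)
Lemma isO_primitive (q : nat) (t0 T : R) (u u' : R -> R) :
  0 < T -> {within `[t0, t0 + T[, continuous u} ->
  (forall t, t0 < t -> t < t0 + T -> is_derive t 1 u (u' t)) ->
  u t0 = 0 -> isO q (fun h => u' (t0 + h)) -> isO q.+1 (fun h => u (t0 + h)).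
Proof.
move=> T0 cu du ut0 /isO_ge0[C C0 /near_right0P[d d0 dC]].
exists C; apply/near_right0P; exists (Num.min d T).
  by rewrite lt_min d0.
move=> h h0; rewrite lt_min => /andP[hd hT].
have th : t0 < t0 + h by rewrite ltrDl.
have [||c] := @MVT R u u' t0 (t0 + h) th.
- move=> x; rewrite in_itv/= => /andP[? xh]; apply: du => //.
  by rewrite (lt_trans xh)// ltrD2l.
- apply: continuous_subspaceW cu => x /=; rewrite !in_itv/= => /andP[-> xh].
  by rewrite (le_lt_trans xh)// ltrD2l.
rewrite in_itv/= ut0 subr0 addrAC subrr add0r => /andP[tc ch] ->.
rewrite exprS [h * _]mulrC mulrA normrM (gtr0_norm h0) ler_wpM2r ?(ltW h0)//.
have c0 : 0 < c - t0 by rewrite subr_gt0.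
have ch' : c - t0 < h by rewrite ltrBlDl.
have := dC (c - t0) c0 (lt_trans ch' hd); rewrite addrC subrK => /le_trans; apply.
by rewrite ler_wpM2l// lerXn2r ?nnegrE ?ltW.
Qed.

Variables (N : nat) (f : 'rV[R]_N -> 'rV[R]_N) (t0 T : R) (y : R -> 'rV[R]_N).
Hypotheses (T0 : 0 < T) (ysol : ode_solution f t0 T y).

Lemma ode_coord_continuous k :
  {within `[t0, t0 + T[, continuous (fun t => y t 0 k)}.
Proof.
move=> t; apply: (@cvg_comp _ _ _ y (fun M : 'rV[R]_N => M 0 k)).
  exact: ysol.1.
exact: coord_continuous.
Qed.

Lemma ode_right_cvg : y (t0 + h) @[h --> 0^'+] --> y t0.
Proof.
have ck k : y (t0 + h) 0 k @[h --> 0^'+] --> y t0 0 k.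
  have T2 : t0 < t0 + T / 2 by rewrite ltrDl divr_gt0.
  have : {within `[t0, t0 + T / 2], continuous (fun t => y t 0 k)}.
    apply: continuous_subspaceW (@ode_coord_continuous k) => x /=.
    rewrite !in_itv/= => /andP[-> xh]; apply: le_lt_trans xh _.
    by rewrite ltrD2l ltr_pdivrMr// ltr_pMr// ltr1n.
  move=> /(continuous_within_itvP _ T2)[_ + _].
  move=> /cvgrPdist_lt yk; apply/cvgrPdist_lt => e /yk.
  move=> [d /= d0 dP]; apply/near_right0P; exists d => // h h0 hd.
  apply: dP => /=; last by rewrite ltrDl.
  by rewrite opprD addrA subrr add0r normrN gtr0_norm.
apply/cvgrPdist_le => e e0; near=> h.
apply: mxnorm_le => [|k]; first exact: ltW.
rewrite !mxE; move: k; near: h; apply: filter_forall => k.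
by have /cvgrPdist_le := ck k; exact.
Unshelve. all: by end_near. Qed.

(** Each comparison of [y] with a Taylor polynomial gains one power of [h] by
    integrating the differential equation. *)
Lemma ode_taylor2 (J : 'I_N -> 'I_N -> R) :
  (forall k, taylor1 (fun x => f x 0 k) (y t0) (J k)) ->
  forall k, isO 3 (fun h => y (t0 + h) 0 k - (y t0 0 k + h * f (y t0) 0 k
    + h ^+ 2 / 2 * \sum_i J k i * f (y t0) 0 i)).
Proof.
move=> fJ.
have dy k t : t0 < t -> t < t0 + T ->
    is_derive t 1 (fun t => y t 0 k) (f (y t) 0 k).
  by move=> t0t tT; apply: is_derive_coord; exact: ysol.2.
have step q k (b c : R) :
   isO q (fun h => f (y (t0 + h)) 0 k - (b + c * h)) ->
   isO q.+1 (fun h => y (t0 + h) 0 k - (y t0 0 k + b * h + c / 2 * h ^+ 2)).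
  move=> H.
  pose pol t := y t0 0 k + b * (t - t0) + c / 2 * (t - t0) ^+ 2.
  have dpol (t : R) : is_derive t 1 pol (b + c * (t - t0)).
    have d1 : is_derive t 1 (fun s : R => s - t0) 1.
      by rewrite -[X in is_derive _ _ _ X]subr0; apply: is_deriveB.
    have -> : b + c * (t - t0) =
        0 + b *: 1 + (c / 2) *: ((t - t0) *: 1 + (t - t0) *: 1).
      by rewrite /GRing.scale/=; field.
    have -> : pol = fun s => y t0 0 k + b * (s - t0) + c / 2 * ((s - t0) * (s - t0)).
      by apply/funext => s; rewrite /pol expr2.
    exact: (is_deriveD (is_deriveD (is_derive_cst _ _ _) (is_deriveZ b d1))
                       (is_deriveZ (c / 2) (is_deriveM d1 d1))).
  have cpol : continuous pol.
    move=> s; apply: differentiable_continuous; apply/derivable1_diffP.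
    by case: (dpol s).
  have := @isO_primitive q t0 T (fun t => y t 0 k - pol t)
     (fun t => f (y t) 0 k - (b + c * (t - t0))) T0.
  case=> //.
  - move=> t; apply: cvgB; first exact: ode_coord_continuous.
    by apply: (continuous_subspaceT cpol).
  - by move=> t t1 t2; apply: is_deriveB => //; exact: dy.
  - by rewrite /pol; ring.
  - by apply: isO_eq H => h _; congr (_ - (_ + _ * _)); ring.
  - move=> C HC; exists C; near=> h.
    have : `|y (t0 + h) 0 k - pol (t0 + h)| <= C * h ^+ q.+1 by near: h.
    by congr (`|_ - _| <= _); rewrite /pol; ring.
have fcvg q k : isO q (fun h => y (t0 + h) - y t0) ->
   isO (q + q) (fun h => f (y (t0 + h)) 0 k - f (y t0) 0 k
     - \sum_i J k i * (y (t0 + h) 0 i - y t0 0 i)).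
  by apply: (taylor1_along (fJ k)); exact: ode_right_cvg.
have O0 : isO 0 (fun h => y (t0 + h) - y t0).
  apply: isOB (isO_cst _); exact: cvg_isO0 ode_right_cvg.
have Ol q k : isO q (fun h => y (t0 + h) - y t0) ->
   isO q (fun h => \sum_i J k i * (y (t0 + h) 0 i - y t0 0 i)).
  move=> /isO_rVP H; apply: isO_sum => i; apply: isOMl.
  by apply: isO_eq (H i) => h _; rewrite !mxE.
have O1 : isO 1 (fun h => y (t0 + h) - y t0).
  apply/isO_rVP => k; have := step 0%N k 0 0.
  case=> [|C HC].
    have H := isOD (fcvg 0%N k O0) (Ol 0%N k O0).
    apply: isO_eq (isOD H (isO_cst (f (y t0) 0 k))) => h _.
    by rewrite mul0r addr0 subr0 !subrK.
  exists C; near=> h.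
  have : `|y (t0 + h) 0 k - (y t0 0 k + 0 * h + 0 / 2 * h ^+ 2)| <= C * h ^+ 1 by near: h.
  by rewrite !mul0r !addr0 !mxE.
have O2 k : isO 2 (fun h => y (t0 + h) 0 k - (y t0 0 k + f (y t0) 0 k * h)).
  have /isO_eq : isO 2 (fun h => y (t0 + h) 0 k
      - (y t0 0 k + f (y t0) 0 k * h + 0 / 2 * h ^+ 2)).
    apply: step => //.
    apply: isO_eq (isOD (isOW _ (fcvg 1%N k O1)) (Ol 1%N k O1)) => // h _.
    by rewrite mul0r addr0 !subrK.
  by apply => h _; rewrite !mul0r addr0.
move=> k.
have /isO_eq : isO 3 (fun h => y (t0 + h) 0 k - (y t0 0 k + f (y t0) 0 k * h
    + (\sum_i J k i * f (y t0) 0 i) / 2 * h ^+ 2)).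
  apply: step => //.
  have O3 : isO 2 (fun h => \sum_i J k i * (y (t0 + h) 0 i - (y t0 0 i + f (y t0) 0 i * h))).
    by apply: isO_sum => i; apply: isOMl.
  apply: isO_eq (isOD (fcvg 1%N k O1) O3) => h _.
  have -> : \sum_i J k i * (y (t0 + h) 0 i - (y t0 0 i + f (y t0) 0 i * h)) =
      \sum_i J k i * (y (t0 + h) 0 i - y t0 0 i)
      - (\sum_i J k i * f (y t0) 0 i) * h.
    by rewrite mulr_suml -sumrB; apply: eq_bigr => i _; ring.
  by ring.
by apply => h _; congr (_ - _); ring.
Unshelve. all: by end_near. Qed.

End OdeExpansion.
(** * The scheme as a pair of Patankar systems *)

Section MoreCalculus.
Variables (R : realType) (N : nat).

Lemma near_pos_orthant (y : 'rV[R]_N) :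
  pos_orthant y -> \forall z \near y, pos_orthant z.
Proof.
move=> y0; near=> z; move=> k; move: k; near: z; apply: filter_forall => k.
have y0k : nbhs (y 0 k) [set x | 0 < x].
  by apply: open_nbhs_nbhs; split; [exact: open_gt|exact: y0].
exact: (@coord_continuous R 1 N 0 k y _ y0k).
Unshelve. all: by end_near. Qed.

Lemma open_pos_orthant : open (@pos_orthant R N).
Proof. by rewrite openE => y /near_pos_orthant. Qed.

Lemma pos_nneg (y : 'rV[R]_N) : pos_orthant y -> nneg_orthant y.
Proof. by move=> y0 k; exact/ltW/y0. Qed.

Lemma taylor1_near (g g' : 'rV[R]_N -> R) y0 J :
  (\forall z \near y0, g z = g' z) -> taylor1 g y0 J -> taylor1 g' y0 J.
Proof.
move=> gg' [C gC]; exists C; near=> z.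
have <- : g z = g' z by near: z.
have <- : g y0 = g' y0 by apply: nbhs_singleton gg'.
by near: z.
Unshelve. all: by end_near. Qed.

Lemma taylor1_sum (I : finType) (g : I -> 'rV[R]_N -> R) y0
    (J : I -> 'I_N -> R) :
  (forall i, taylor1 (g i) y0 (J i)) ->
  taylor1 (fun y => \sum_i g i y) y0 (fun j => \sum_i J i j).
Proof.
move=> gJ.
pose C i := sval (cid (gJ i)); have CP i := svalP (cid (gJ i)).
exists (\sum_i C i); near=> z.
rewrite -sumrB (eq_bigr (fun j => \sum_i J i j * (z 0 j - y0 0 j))); last first.
  by move=> j _; rewrite mulr_suml.
rewrite exchange_big -sumrB mulr_suml (le_trans (ler_norm_sum _ _ _))//.
apply: ler_sum => i _; move: i; near: z; apply: filter_forall => i.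
exact: CP.
Unshelve. all: by end_near. Qed.

Lemma isO_inv (u : R -> R) (l : R) :
  l != 0 -> u h @[h --> 0^'+] --> l -> isO 0 (fun h => (u h)^-1).
Proof. by move=> l0 ul; apply: (@cvg_isO0 _ _ _ l^-1); exact: cvgV. Qed.

Lemma isO_flux a b (M : 'I_N -> 'I_N -> R -> R) (x : 'I_N -> R -> R) k :
  (forall i j, isO a (M i j)) -> (forall i, isO b (x i)) ->
  isO (a + b) (fun h => flux (fun i j => M i j h) (fun i => x i h) k).
Proof.
by move=> hM hx; apply: isO_sum => nu; apply: isOB; apply: isOM.
Qed.

Lemma isO_fluxr b (M : 'I_N -> 'I_N -> R) (x : 'I_N -> R -> R) k :
  (forall i, isO b (x i)) -> isO b (fun h => flux M (fun i => x i h) k).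
Proof.
move=> hx; apply: (@isO_flux 0 b (fun i j _ => M i j)) => // i j.
exact: isO_cst.
Qed.

Lemma cvg_rVP (u : R -> 'rV[R]_N) (l : 'rV[R]_N) :
  isO 1 (fun h => u h - l) -> u h @[h --> 0^'+] --> l.
Proof.
by move=> /isO_cvg0 H; apply/subr_cvg0.
Qed.

End MoreCalculus.

Section ConservativePDS.
Variables (R : realType) (N : nat) (p d : 'I_N -> 'I_N -> 'rV[R]_N -> R).
Hypothesis pd : conservative_pds p d.

Lemma patankar_rhsE y z w k : nneg_orthant y ->
  patankar_rhs p d y z w 0 k = flux (fun i j => p i j y) (fun i => z 0 i / w 0 i) k.
Proof.
move=> y0; rewrite mxE; apply: eq_bigr => nu _.
by have [_ _ -> _ _] := pd y0 nu k.
Qed.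

Lemma pds_rhsE y k : nneg_orthant y ->
  pds_rhs p d y 0 k = flux (fun i j => p i j y) (fun=> 1) k.
Proof.
move=> y0; rewrite mxE; apply: eq_bigr => nu _.
by have [_ _ -> _ _] := pd y0 nu k; rewrite !mulr1.
Qed.

(** Smoothness is assumed for the splitting; this transfers it to the sum. *)
Lemma pds_rhs_split y k : nneg_orthant y ->
  pds_rhs p d y 0 k = \sum_nu pds_split p d nu y 0 k.
Proof.
move=> y0; rewrite mxE sumrB (bigD1 k)//= [RHS](bigD1 k)//= !mxE eqxx.
have [_ _ _ -> _] := pd y0 k k; rewrite add0r addrC; congr (_ + _).
by apply: eq_bigr => nu nuk; rewrite mxE eq_sym (negPf nuk).
Qed.

Variables (A : 'M[R]_2) (b : 'rV[R]_2).
Variables (pi1 : 'rV[R]_N -> 'rV[R]_N) (pi2 : 'rV[R]_N * 'rV[R]_N -> 'rV[R]_N).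
Variable yn : 'rV[R]_N.
Hypothesis yn0 : pos_orthant yn.

(** As the first stage is [yn], the second one only sees the production terms at
    [yn]: problems with the same values there share their stages. *)
Lemma mprk2_stagesE h Y : mprk2_stages A pi1 pi2 p d yn h Y <->
  Y 0 = yn /\ patankar_sys h (fun i j => A 1 0 * p i j yn) yn (pi2 (yn, yn)) (Y 1).
Proof.
have stage1 (Y' : 'I_2 -> 'rV[R]_N) : Y' 0 = yn -> forall k : 'I_N,
  (yn + h *: \sum_(j < 2 | (j < (1%R : 'I_2))%N) A 1 j *:
    patankar_rhs p d (Y' j) (Y' 1) (pi2 (yn, yn))) 0 k =
  yn 0 k + h * flux (fun i j => A 1 0 * p i j yn)
                    (fun i => Y' 1 0 i / pi2 (yn, yn) 0 i) k.
  move=> Y'0 k; rewrite big_mkcond !big_ord_recl big_ord0/= !addr0 Y'0.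
  rewrite fluxZl -patankar_rhsE; last exact: pos_nneg.
  by rewrite !mxE. 
split.
  move=> st; have Y0 : Y 0 = yn.
    by have := st 0; rewrite big_pred0// ?scaler0 ?addr0.
  split=> // k; have := st 1; rewrite /= Y0 => /rowP/(_ k) E.
  by rewrite -stage1// -E.
move=> [Y0 Y1] i; have [->|->] : i = 0 \/ i = 1.
- by case: i => [[|[|//]] ?]; [left|right]; exact: val_inj.
- by rewrite big_pred0// scaler0 addr0.
- apply/rowP => k; rewrite Y1 Y0; exact/esym/stage1.
Qed.

Lemma mprk_updateE h Y w yh : nneg_orthant (Y 0) -> nneg_orthant (Y 1) ->
  mprk_update b p d h yn Y w yh <->
  patankar_sys h (fun i j => b 0 0 * p i j (Y 0) + b 0 1 * p i j (Y 1)) yn w yh.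
Proof.
move=> Y0 Y1.
have E k : (yn + h *: \sum_(j < 2) b 0 j *: patankar_rhs p d (Y j) yh w) 0 k =
  yn 0 k + h * flux (fun i j => b 0 0 * p i j (Y 0) + b 0 1 * p i j (Y 1))
                    (fun i => yh 0 i / w 0 i) k.
  rewrite !big_ord_recl big_ord0 addr0 fluxDl !fluxZl -!patankar_rhsE//.
  have -> : lift ord0 ord0 = 1 :> 'I_2 by apply: val_inj.
  by rewrite !mxE.
split=> [H k|H]; first by rewrite -E -H.
by apply/rowP => k; rewrite E; exact: H.
Qed.

End ConservativePDS.

(** On [y_0' = 1, y_1' = 2 y_0] with the solution [(t, t^2)] the error of a step
    is [h (b_1 + b_2 - 1)] in the first component and
    [h^2 (2 b_2 a_21 - 1)] in the second. *)
Lemma rk2_order_conditions (R : realType) (A : 'M[R]_2) (b : 'rV[R]_2) :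
  rk_explicit A -> rk_order A b 2 ->
  b 0 0 + b 0 1 = 1 /\ b 0 1 * A 1 0 = 2^-1.
Proof.
move=> Aexpl ord.
pose vec2 (u v : R) : 'rV[R]_2 := \row_k (if k == 0 then u else v).
pose f (y : 'rV[R]_2) : 'rV[R]_2 := vec2 1 (2 * y 0 0).
have f_Ck k : Ck 3 setT (fun y => f y 0 k).
  have -> : (fun y => f y 0 k) =
      (fun y => (k == 0)%:R + (if k == 0 then 0 else 2) * y 0 0).
    by apply/funext => y; rewrite mxE; case: ifP => _; rewrite ?mul0r ?addr0 ?add0r.
  exact: Ck_affine.
pose Y (h : R) (i : 'I_2) := if i == 0 then 0 else h *: (A 1 0 *: f 0).
pose Phi (h : R) := h *: (b 0 0 *: f 0 + b 0 1 *: f (Y h 1)).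
have step h : 0 < h -> rk_step A b f h 0 (Y h) (Phi h).
  move=> _; split=> [i|]; last first.
    rewrite !big_ord_recl big_ord0 addr0 add0r.
    by have -> : lift ord0 ord0 = 1 :> 'I_2 by apply: val_inj.
  have A2 : A i 1 = 0 by apply: Aexpl; case: i => [[|[|]]].
  rewrite !big_ord_recl big_ord0 addr0 add0r.
  have -> : lift ord0 ord0 = 1 :> 'I_2 by apply: val_inj.
  rewrite A2 scale0r addr0 /Y eqxx.
  case: eqP => [->|/eqP i0]; first by rewrite Aexpl// scale0r scaler0.
  by have -> : i = 1 by apply: val_inj; case: i {A2} i0 => [[|[|]]].
pose y (t : R) := vec2 t (t ^+ 2).
have ysol : ode_solution f 0 1 y.
  have dy (t : R) : is_derive t 1 y (f (y t)).
    have dk k : is_derive t 1 (fun s => y s 0 k) (f (y t) 0 k).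
      have -> : (fun s => y s 0 k) = if k == 0 then id else (id : R -> R) ^+ 2.
        by apply/funext => s; rewrite mxE; case: ifP.
      rewrite mxE; case: ifP => _; apply: is_derive_eq => //.
      by rewrite mxE /= /GRing.scale/= mulr1.
    have dy : derivable y t 1.
      by apply/derivable_mxP => i k; rewrite ord1; case: (dk k).
    apply: DeriveDef => //; rewrite derive_mx//; apply/matrixP => i k.
    by rewrite ord1 mxE; case: (dk k).
  split=> //; apply: continuous_subspaceT => t.
  apply: differentiable_continuous; apply/derivable1_diffP.
  by case: (dy t).
have y0 : y 0 = 0 by apply/rowP => k; rewrite !mxE expr0n/=; case: ifP.
have := ord _ _ f_Ck _ _ _ step 0 1 y ltr01 ysol y0.
move=> /isO_bigO/isO_rVP H.
split.
- have E h : 0 < h -> (Phi h - y (0 + h)) 0 0 = h * (b 0 0 + b 0 1 - 1).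
    by move=> _; rewrite !mxE/=; ring.
  have /isO_divh/isO_cst_eq0/eqP := isO_eq E (H 0).
  by rewrite subr_eq0 => /eqP.
- have E h : 0 < h ->
      (Phi h - y (0 + h)) 0 1 = h * (h * (2 * (b 0 1 * A 1 0) - 1)).
    by move=> _; rewrite !mxE/=; ring.
  have /isO_divh/isO_divh/isO_cst_eq0 ba := isO_eq E (H 1).
  by lra.
Qed.
(** * The conditions are sufficient *)

Section ClassTaylor.
Variables (R : realType) (N : nat) (r : nat).
Variables (p d : 'I_N -> 'I_N -> 'rV[R]_N -> R) (yn : 'rV[R]_N).
Hypotheses (pdC : pds_class r.+2 p d) (yn0 : pos_orthant yn).

Lemma split_taylor1 nu k :
  exists J, taylor1 (fun y => pds_split p d nu y 0 k) yn J.
Proof.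
by apply: (Ck_taylor1 (@open_pos_orthant R N) yn0); case: pdC => _ _; exact.
Qed.

Lemma pds_rhs_taylor1 :
  exists J, forall k, taylor1 (fun y => pds_rhs p d y 0 k) yn (J k).
Proof.
have [J JP] : exists J : 'I_N -> 'I_N -> 'I_N -> R,
    forall nu k, taylor1 (fun y => pds_split p d nu y 0 k) yn (J nu k).
  exists (fun nu k => sval (cid (split_taylor1 nu k))) => nu k.
  exact: svalP.
exists (fun k i => \sum_nu J nu k i) => k.
apply: taylor1_near (taylor1_sum (fun nu => JP nu k)).
near=> z; rewrite (@pds_rhs_split _ _ p d)//; first by case: pdC.
by apply: pos_nneg; near: z; exact: near_pos_orthant.
Unshelve. all: by end_near. Qed.

Lemma taylor1_isO1 (g : 'rV[R]_N -> R) J (Z : R -> 'rV[R]_N) :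
  taylor1 g yn J -> isO 1 (fun h => Z h - yn) ->
  isO 1 (fun h => g (Z h) - g yn).
Proof.
move=> gJ Z1.
have lin : isO 1 (fun h => \sum_i J i * (Z h 0 i - yn 0 i)).
  apply: isO_sum => i; apply: isOMl.
  by apply: isO_eq ((isO_rVP _ _).1 Z1 i) => h _; rewrite !mxE.
have rem := isOW (isT : 1 <= 1 + 1)%N (taylor1_along gJ (cvg_rVP Z1) Z1).
by apply: isO_eq (isOD rem lin) => h _; rewrite subrK.
Qed.

(** The diagonal is treated apart: [pds_split] holds destruction terms there, but
    the diagonal production vanishes. *)
Lemma production_isO1 (Z : R -> 'rV[R]_N) i j :
  (forall h, 0 < h -> pos_orthant (Z h)) -> isO 1 (fun h => Z h - yn) ->
  isO 1 (fun h => p i j (Z h) - p i j yn).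
Proof.
move=> Z0 Z1; case: pdC => cons _ _.
have [->|ij] := eqVneq i j.
  apply: isO_eq (isO0 _ 1) => h h0.
  have [_ _ _ -> _] := cons _ (pos_nneg (Z0 h h0)) j j.
  by have [_ _ _ -> _] := cons _ (pos_nneg yn0) j j; rewrite subrr.
have [J JP] := split_taylor1 j i.
apply: isO_eq (taylor1_isO1 JP Z1) => h _.
by rewrite !mxE (negPf ij).
Qed.

End ClassTaylor.

Section TwoStageScheme.
Variables (R : realType) (N : nat) (A : 'M[R]_2) (b : 'rV[R]_2).
Variables (pi1 : 'rV[R]_N -> 'rV[R]_N) (pi2 : 'rV[R]_N * 'rV[R]_N -> 'rV[R]_N)
  (sigma : 'rV[R]_N * 'rV[R]_N * 'rV[R]_N -> 'rV[R]_N).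
Hypotheses (a0 : 0 <= A 1 0) (b0 : forall j, 0 <= b 0 j).
Hypothesis hpwd : admissible_pwd pi1 pi2 sigma.
Variable yn : 'rV[R]_N.
Hypothesis yn0 : pos_orthant yn.

Lemma pi2_gt0 : pos_orthant (pi2 (yn, yn)).
Proof. by case: hpwd => _ H _; case: (H (yn, yn)). Qed.

Lemma sigma_gt0 z : pos_orthant z -> pos_orthant (sigma (yn, yn, z)).
Proof. by move=> z0; case: hpwd => _ _ H; case: (H (yn, yn, z)). Qed.

Lemma sigma_cvg (Z : R -> 'rV[R]_N) : isO 1 (fun h => Z h - yn) ->
  sigma (yn, yn, Z h) @[h --> 0^'+] --> sigma (yn, yn, yn).
Proof.
move=> Z1; have [_ _ /(_ (yn, yn, yn) yn0 yn0 yn0)[_ sc]] := hpwd.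
apply: (@cvg_comp _ _ _ (fun h => (yn, yn, Z h)) sigma _ _ _ _ sc).
exact: (cvg_pair (cvg_cst (yn, yn)) (cvg_rVP Z1)).
Qed.

Lemma sigma_inv_isO0 (Z : R -> 'rV[R]_N) i : isO 1 (fun h => Z h - yn) ->
  isO 0 (fun h => (sigma (yn, yn, Z h) 0 i)^-1).
Proof.
move=> Z1; apply: (@isO_inv _ _ (sigma (yn, yn, yn) 0 i)).
  by rewrite gt_eqF// sigma_gt0.
apply: (@cvg_comp _ _ _ _ (fun s : 'rV[R]_N => s 0 i) _ _ _ (sigma_cvg Z1)).
exact: coord_continuous.
Qed.

(** The second stage, as a curve in [h], depends on the problem only through the
    matrix [P] of the production terms at [yn]. *)
Definition stage2 (P : 'I_N -> 'I_N -> R) (Z : R -> 'rV[R]_N) : Prop :=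
  forall h, 0 < h ->
    patankar_sys h (fun i j => A 1 0 * P i j) yn (pi2 (yn, yn)) (Z h).

Section Stage2.
Variables (P : 'I_N -> 'I_N -> R) (Z : R -> 'rV[R]_N).
Hypotheses (P0 : forall i j, 0 <= P i j) (ZP : stage2 P Z).

Let aP0 i j : 0 <= A 1 0 * P i j. Proof. exact: mulr_ge0. Qed.

Lemma stage2_gt0 h : 0 < h -> pos_orthant (Z h).
Proof.
by move=> h0; apply: (patankar_sys_gt0 (ltW h0) aP0 pi2_gt0 (ZP h0) yn0).
Qed.

Lemma stage2_isO1 : isO 1 (fun h => Z h - yn).
Proof.
apply/isO_rVP => k.
have /isO_hM : isO 0 (fun h => flux (fun i j => A 1 0 * P i j)
    (fun i => Z h 0 i / pi2 (yn, yn) 0 i) k).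
  apply: isO_fluxr => i; apply: (@isOM _ 0 0) (isO_cst _).
  apply: (isO_bounded (C := \sum_i yn 0 i)) => h h0.
  exact: (patankar_sys_le (ltW h0) aP0 pi2_gt0 i (ZP h0) yn0).
apply: isO_eq => h h0; rewrite !mxE (ZP h0).
by rewrite addrAC subrr add0r.
Qed.

End Stage2.

(** What a step needs: matrices of production terms that stay bounded, and a
    stage that tends to [yn], so that the denominators tend to a positive limit. *)
Section Update.
Variables (M : R -> 'I_N -> 'I_N -> R) (Z : R -> 'rV[R]_N) (Phi : R -> 'rV[R]_N).
Hypothesis M0 : forall h, 0 < h -> forall i j, 0 <= M h i j.
Hypothesis Mb : forall i j, isO 0 (fun h => M h i j).
Hypotheses (Z0 : forall h, 0 < h -> pos_orthant (Z h)).
Hypothesis Z1 : isO 1 (fun h => Z h - yn).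
Hypothesis PhiP : forall h, 0 < h ->
  patankar_sys h (M h) yn (sigma (yn, yn, Z h)) (Phi h).

Lemma update_ratio_isO0 i :
  isO 0 (fun h => Phi h 0 i / sigma (yn, yn, Z h) 0 i).
Proof.
apply: (@isOM _ 0 0) (sigma_inv_isO0 i Z1).
apply: (isO_bounded (C := \sum_i yn 0 i)) => h h0.
by apply: (patankar_sys_le (ltW h0) (M0 h0) (sigma_gt0 (Z0 h0)) i (PhiP h0)).
Qed.

Lemma update_isO1 i : isO 1 (fun h => Phi h 0 i - yn 0 i).
Proof.
have /isO_hM := isO_flux i Mb update_ratio_isO0.
apply: isO_eq => h h0; rewrite (PhiP h0).
by rewrite addrAC subrr add0r.
Qed.

(** The errors of the ratios enter through a flux, which is multiplied by [h]:
    this is where a power of [h] is gained. *)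
Lemma update_unweighted q k :
  (forall i, isO q (fun h => Phi h 0 i - sigma (yn, yn, Z h) 0 i)) ->
  isO q.+1 (fun h => Phi h 0 k - (yn 0 k + h * flux (M h) (fun=> 1) k)).
Proof.
move=> PS.
have r1 i : isO q (fun h => Phi h 0 i / sigma (yn, yn, Z h) 0 i - 1).
  have := isOM (PS i) (sigma_inv_isO0 i Z1); rewrite addn0.
  apply: isO_eq => h h0.
  by rewrite mulrBl divff// gt_eqF// sigma_gt0//; exact: Z0.
have /isO_hM := isO_flux k Mb r1; rewrite add0n.
apply: isO_eq => h h0; rewrite fluxBr (PhiP h0) mulrBr.
by rewrite opprD addrACA subrr add0r.
Qed.

End Update.

Lemma update_exists h M w : 0 < h -> (forall i j, 0 <= M i j) -> pos_orthant w ->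
  exists z, patankar_sys h M yn w z.
Proof. by move=> h0 M0 w0; apply: patankar_sys_exists => //; exact: ltW. Qed.

(** The ratios [Phi / sigma] improve from bounded to [1 + O(h)], since both vectors
    tend to [yn], and then to [1 + O(h^2)], since both expand as [yn + h f]. *)
Lemma mprk2_sufficient (p d : 'I_N -> 'I_N -> 'rV[R]_N -> R) r :
  b 0 0 + b 0 1 = 1 -> b 0 1 * A 1 0 = 2^-1 ->
  pds_class r.+2 p d -> pwd_conditions A pi1 pi2 sigma p d yn ->
  mprk2_order A b pi1 pi2 sigma p d yn 2.
Proof.
move=> b1 ba pdC cond Y Phi step tn T y T0 ysol ytn.
have cons : conservative_pds p d by case: pdC.
pose Z h := Y h 1; pose P i j := p i j yn.
have P0 i j : 0 <= P i j by case: (cons _ (pos_nneg yn0) i j).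
have st h (h0 : 0 < h) := (mprk2_stagesE cons A pi1 pi2 yn0 h (Y h)).1 (step h h0).1.
have Y0 h : 0 < h -> Y h 0 = yn by move=> h0; case: (st h h0).
have ZP : stage2 P Z by move=> h h0; case: (st h h0).
have Z0 := stage2_gt0 P0 ZP; have Z1 := stage2_isO1 P0 ZP.
have [c1 c2] := cond Y (fun h h0 => (step h h0).1).
have pi2E : pi2 (yn, yn) = yn.
  apply/rowP => nu; apply/eqP; rewrite -subr_eq0; apply/eqP.
  apply: (@isO_cst_eq0 R 0); have := c1 nu.
  have -> : (fun h : R => h) =  (fun h : R => h ^+ 1) by [].
  move=> /isO_bigO; apply: isO_eq => h h0; by rewrite Y0.
have sO i : isO 2 (fun h => sigma (yn, yn, Z h) 0 i - (yn 0 i + h * pds_rhs p d yn 0 i)).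
  by have /isO_bigO := c2 i; apply: isO_eq => h h0; rewrite Y0.
pose M h i j := b 0 0 * p i j yn + b 0 1 * p i j (Z h).
have pZ i j := production_isO1 pdC yn0 i j Z0 Z1.
have pO0 i j : isO 0 (fun h => p i j (Z h)).
  have := isOD (isOW (isT : 0 <= 1)%N (pZ i j)) (isO_cst (p i j yn)).
  by apply: isO_eq => h _; rewrite subrK.
have Mb i j : isO 0 (fun h => M h i j).
  by apply: isOD (isO_cst _) _; exact: isOMl.
have M0 h : 0 < h -> forall i j, 0 <= M h i j.
  move=> h0 i j; apply: addr_ge0; apply: mulr_ge0 => //; first exact: P0.
  by case: (cons _ (pos_nneg (Z0 h h0)) i j).
have PhiP h : 0 < h -> patankar_sys h (M h) yn (sigma (yn, yn, Z h)) (Phi h).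
  move=> h0; have := (step h h0).2.
  rewrite (mprk_updateE cons) ?Y0//; first exact: pos_nneg.
  exact/pos_nneg/Z0.
have [J JP] := pds_rhs_taylor1 pdC yn0.
pose f k := pds_rhs p d yn 0 k.
pose Jf k := \sum_i J k i * f i.
have fE k : f k = flux P (fun=> 1) k by apply: pds_rhsE => //; exact: pos_nneg.
have hf k : isO 1 (fun h : R => h * f k) by apply: isO_hM; exact: isO_cst.
have PhiO1 k := update_isO1 M0 Mb Z0 Z1 PhiP k.
have PS1 k : isO 1 (fun h => Phi h 0 k - sigma (yn, yn, Z h) 0 k).
  apply: isO_eq (isOB (isOB (PhiO1 k) (isOW _ (sO k))) (hf k)) => // h _.
  by rewrite /f; ring.
(* The unweighted step is the Runge-Kutta step with the Patankar stage. *)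
have rkE h k : 0 < h ->
    flux (M h) (fun=> 1) k = f k + b 0 1 * (pds_rhs p d (Z h) 0 k - f k).
  move=> h0; rewrite /M fluxDl !fluxZl -!(pds_rhsE cons)//.
  - transitivity ((b 0 0 + b 0 1) * f k + b 0 1 * (pds_rhs p d (Z h) 0 k - f k)).
      by rewrite /f; ring.
    by rewrite b1 mul1r.
  - exact/pos_nneg/Z0.
  - exact/pos_nneg.
have PS2 k : isO 2 (fun h => Phi h 0 k - sigma (yn, yn, Z h) 0 k).
  have := update_unweighted Mb Z0 Z1 PhiP k PS1.
  have /(isOMl (b 0 1))/isO_hM fZ := taylor1_isO1 (JP k) Z1.
  move=> /isOD/(_ fZ)/isOB/(_ (sO k)); apply: isO_eq => h h0.
  by rewrite rkE// /f; ring.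
have Phi3 k := update_unweighted Mb Z0 Z1 PhiP k PS2.
(* The stage is an Euler step of length a h, up to second order. *)
have Z2 k : isO 2 (fun h => Z h 0 k - yn 0 k - h * (A 1 0 * f k)).
  have zr i : isO 1 (fun h => Z h 0 i / yn 0 i - 1).
    have := isOM ((isO_rVP _ _).1 Z1 i) (isO_cst (yn 0 i)^-1).
    apply: isO_eq => h _; rewrite !mxE mulrBl divff// gt_eqF//; exact: yn0.
  have /isO_hM := isO_fluxr (fun i j => A 1 0 * P i j) k zr.
  apply: isO_eq => h h0; rewrite (ZP h h0 k) pi2E fluxBr.
  by rewrite [flux _ (fun=> 1) k]fluxZl fE; ring.
have rk3 k : isO 2 (fun h => flux (M h) (fun=> 1) k - (f k + h / 2 * Jf k)).
  have JZ : isO 2 (fun h => \sum_i J k i * (Z h 0 i - yn 0 i - h * (A 1 0 * f i))).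
    by apply: isO_sum => i; exact: isOMl.
  have fZ := taylor1_along (JP k) (cvg_rVP Z1) Z1.
  have := isOMl (b 0 1) (isOD fZ JZ); apply: isO_eq => h h0.
  have -> : \sum_i J k i * (Z h 0 i - yn 0 i - h * (A 1 0 * f i)) =
      \sum_i J k i * (Z h 0 i - yn 0 i) - h * A 1 0 * Jf k.
    by rewrite mulr_sumr -sumrB; apply: eq_bigr => i _; ring.
  rewrite rkE// -[2^-1]ba /f; ring.
apply/isO_bigO/isO_rVP => k.
have yT := ode_taylor2 T0 ysol (J := J); rewrite ytn in yT.
have := isOB (isOD (Phi3 k) (isO_hM (rk3 k))) (yT JP k).
apply: isO_eq => h h0.
have -> : (Phi h - y (tn + h)) 0 k = Phi h 0 k - y (tn + h) 0 k by rewrite !mxE.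
by rewrite /Jf /f; field.
Qed.

End TwoStageScheme.
(** * Affine test problems *)

Section AffinePDS.
Variables (R : realType) (N : nat) (C B : 'I_N -> 'I_N -> R).
Hypotheses (C0 : forall i j, 0 <= C i j) (B0 : forall i j, 0 <= B i j).
Hypotheses (Cd : forall i, C i i = 0) (Bd : forall i, B i i = 0).

(** Each part of the splitting is affine in a single component, which makes
    smoothness and the Lipschitz condition immediate. *)
Definition affine_production (k nu : 'I_N) (y : 'rV[R]_N) : R :=
  C k nu + B k nu * y 0 nu.
Definition affine_destruction (k nu : 'I_N) : 'rV[R]_N -> R :=
  affine_production nu k.

Lemma affine_conservative :
  conservative_pds affine_production affine_destruction.
Proof.
move=> y y0 k nu; rewrite /affine_destruction /affine_production Cd Bd mul0r addr0.
by split=> //; rewrite addr_ge0// mulr_ge0.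
Qed.

Lemma affine_splitE nu k y :
  pds_split affine_production affine_destruction nu y 0 k =
  (if k == nu then - \sum_mu C mu k else C k nu) +
  (if k == nu then - \sum_mu B mu k else B k nu) * y 0 nu.
Proof.
rewrite mxE; case: eqP => [->|//].
by rewrite big_split/= -mulr_suml opprD mulNr.
Qed.

Lemma affine_class r : pds_class r affine_production affine_destruction.
Proof.
split; first exact: affine_conservative.
- move=> nu.
  have ne : (@nneg_orthant R N `*` @nneg_orthant R N) (0, 0).
    by split=> k /=; rewrite mxE.
  pose be k := if k == nu then - \sum_mu B mu k else B k nu.
  have FF := globally_properfilter ne.
  apply: (@klipschitzW _ _ _ (\sum_k `|be k|)) => -[y z] _ /=.
  apply: mxnorm_le => [|k]; first by rewrite mulr_ge0// sumr_ge0.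
  pose S := pds_split affine_production affine_destruction nu.
  have -> : (S y - S z) 0 k = S y 0 k - S z 0 k by rewrite !mxE.
  rewrite !affine_splitE -/(be k) opprD addrACA subrr add0r -mulrBr normrM ler_pM//.
    by rewrite (bigD1 k)//= lerDl sumr_ge0.
  by have := ler_mxnorm (y - z) nu; rewrite !mxE.
- move=> nu k.
  have -> : (fun y => pds_split affine_production affine_destruction nu y 0 k) =
    (fun y => (if k == nu then - \sum_mu C mu k else C k nu) +
              (if k == nu then - \sum_mu B mu k else B k nu) * y 0 nu).
    by apply/funext => y; exact: affine_splitE.
  exact: Ck_affine.
Qed.

Lemma affine_rhsE y k : pds_rhs affine_production affine_destruction y 0 k =
  flux (fun i j => C i j + B i j * y 0 j) (fun=> 1) k.
Proof.
by rewrite mxE; apply: eq_bigr => nu _; rewrite !mulr1.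
Qed.

End AffinePDS.

Definition transfer (R : realType) (N : nat) (k j : 'I_N) (m : R) : 'I_N -> 'I_N -> R :=
  fun i l => m * ((i == k) && (l == j))%:R.

Lemma flux_transfer (R : realType) (N : nat) (k j : 'I_N) (m : R) x i :
  flux (transfer k j m) x i = m * x j * ((i == k)%:R - (i == j)%:R).
Proof.
rewrite /flux /transfer sumrB mulrBr; congr (_ - _).
  rewrite (bigD1 j)//= eqxx andbT big1 ?addr0; last first.
    by move=> l /negPf ->; rewrite andbF mulr0 mul0r.
  by ring.
rewrite (bigD1 k)//= eqxx big1 ?addr0; last first.
  by move=> l /negPf ->; rewrite mulr0 mul0r.
by have [->|] := eqVneq i j; rewrite ?mulr0 ?mul0r//; ring.
Qed.

Lemma transfer_ge0 (R : realType) (N : nat) (k j : 'I_N) (m : R) i l :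
  0 <= m -> 0 <= transfer k j m i l.
Proof. by move=> m0; rewrite mulr_ge0. Qed.

Lemma transfer_diag (R : realType) (N : nat) (k j : 'I_N) (m : R) i :
  k != j -> transfer k j m i i = 0.
Proof.
move=> kj; rewrite /transfer; have [->|] := eqVneq i k; last by rewrite mulr0.
by rewrite (negPf kj) mulr0.
Qed.

Section ExactSolutions.
Variables (R : realType) (N : nat).

Lemma is_derive_along (phi : R -> R) (yn v : 'rV[R]_N) (t l : R) :
  is_derive t 1 phi l -> is_derive t 1 (fun s => yn + phi s *: v) (l *: v).
Proof.
move=> dphi.
have dk k : is_derive t 1 (fun s => (yn + phi s *: v) 0 k) (l * v 0 k).
  have -> : (fun s => (yn + phi s *: v) 0 k) = cst (yn 0 k) + v 0 k *: phi.
    by apply/funext => s; rewrite !mxE mulrC.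
  rewrite mulrC -[X in is_derive _ _ _ X]add0r.
  exact: (is_deriveD (is_derive_cst _ _ _) (is_deriveZ (v 0 k) dphi)).
have dy : derivable (fun s => yn + phi s *: v) t 1.
  by apply/derivable_mxP => i k; rewrite ord1; case: (dk k).
apply: DeriveDef => //; rewrite derive_mx//; apply/matrixP => i k.
by rewrite ord1 !mxE; case: (dk k).
Qed.

Lemma ode_solution_along (f : 'rV[R]_N -> 'rV[R]_N) (phi phi' : R -> R) yn v :
  (forall t : R, is_derive t 1 phi (phi' t)) ->
  (forall t, f (yn + phi t *: v) = phi' t *: v) ->
  ode_solution f 0 1 (fun t => yn + phi t *: v).
Proof.
move=> dphi fE; split=> [|t _ _]; last by rewrite fE; exact: is_derive_along.
apply: continuous_subspaceT => t.
apply: differentiable_continuous; apply/derivable1_diffP.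
by case: (is_derive_along yn v (dphi t)).
Qed.

End ExactSolutions.

(** Near [0] the new parameter is at most [2 h]. *)
Lemma isO_reparam (R : realType) q (u : R -> R) :
  isO q u -> isO q (fun h => u (h / (1 - h))).
Proof.
move=> /isO_ge0[C C0 /near_right0P[d d0 dC]].
exists (C * 2 ^+ q); apply/near_right0P; exists (Num.min (d / 2) 2^-1).
  by rewrite lt_min divr_gt0//= invr_gt0.
move=> h h0; rewrite lt_min => /andP[hd h2].
have h1 : 0 < 1 - h by lra.
have hh : h / (1 - h) <= 2 * h.
  by rewrite ler_pdivrMr// mulrAC ler_peMl ?ltW//; lra.
have hp : 0 < h / (1 - h) by rewrite divr_gt0.
apply: le_trans (dC _ hp _) _; first by lra.
have h20 : 0 <= 2 * h by lra.
by rewrite -mulrA -exprMn ler_wpM2l// lerXn2r// nnegrE ltW.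
Qed.
(** * The conditions are necessary *)

Section Necessity.
Variables (R : realType) (N : nat) (A : 'M[R]_2) (b : 'rV[R]_2).
Variables (pi1 : 'rV[R]_N -> 'rV[R]_N) (pi2 : 'rV[R]_N * 'rV[R]_N -> 'rV[R]_N)
  (sigma : 'rV[R]_N * 'rV[R]_N * 'rV[R]_N -> 'rV[R]_N).
Hypotheses (a0 : 0 <= A 1 0) (b0 : forall j, 0 <= b 0 j).
Hypotheses (b1 : b 0 0 + b 0 1 = 1) (ba : b 0 1 * A 1 0 = 2^-1).
Hypothesis hpwd : admissible_pwd pi1 pi2 sigma.
Variable yn : 'rV[R]_N.
Hypothesis yn0 : pos_orthant yn.
Hypothesis ord : forall p d : 'I_N -> 'I_N -> 'rV[R]_N -> R,
  pds_class 3 p d -> mprk2_order A b pi1 pi2 sigma p d yn 2.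

Local Notation stage2 := (stage2 A pi2 yn).
Local Notation sigmaZ Z h := (sigma (yn, yn, Z h)).

Lemma stage2_exists (P : 'I_N -> 'I_N -> R) :
  (forall i j, 0 <= P i j) -> exists Z, stage2 P Z.
Proof.
move=> P0.
have [|Z ZP] := @choice R 'rV[R]_N (fun h z => 0 < h ->
    patankar_sys h (fun i j => A 1 0 * P i j) yn (pi2 (yn, yn)) z).
  move=> h; have [h0|h0] := ltP 0 h; last by exists 0.
  have [|z zP] := update_exists yn (M := fun i j => A 1 0 * P i j) h0 _ (pi2_gt0 hpwd yn0).
    by move=> i j; exact: mulr_ge0.
  by exists z.
by exists Z.
Qed.

(** The order hypothesis in usable form.  Since a stage curve is prescribed first,
    it can be shared between problems with the same [stage2]. *)
Lemma order_step (p d : 'I_N -> 'I_N -> 'rV[R]_N -> R) (Z : R -> 'rV[R]_N) :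
  pds_class 3 p d -> stage2 (fun i j => p i j yn) Z ->
  exists Phi : R -> 'rV[R]_N,
    (forall h, 0 < h -> patankar_sys h
       (fun i j => b 0 0 * p i j yn + b 0 1 * p i j (Z h)) yn (sigmaZ Z h) (Phi h))
    /\ forall y, ode_solution (pds_rhs p d) 0 1 y -> y 0 = yn ->
         isO 3 (fun h => Phi h - y h).
Proof.
move=> pdC ZP; have cons : conservative_pds p d by case: pdC.
have P0 i j : 0 <= p i j yn by case: (cons _ (pos_nneg yn0) i j).
have Z0 := stage2_gt0 a0 hpwd yn0 P0 ZP.
pose M h i j := b 0 0 * p i j yn + b 0 1 * p i j (Z h).
have [|Phi PhiP] := @choice R 'rV[R]_N (fun h z => 0 < h ->
    patankar_sys h (M h) yn (sigmaZ Z h) z).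
  move=> h; have [h0|h0] := ltP 0 h; last by exists 0.
  have [|z zP] := update_exists yn (M := M h) h0 _ (sigma_gt0 hpwd yn0 (Z0 h h0)).
    move=> i j; apply: addr_ge0; apply: mulr_ge0 => //.
    by case: (cons _ (pos_nneg (Z0 h h0)) i j).
  by exists z.
exists Phi; split=> // y ysol y0.
pose Y h (i : 'I_2) := if i == 0 then yn else Z h.
have step h : 0 < h -> mprk2_step A b pi1 pi2 sigma p d yn h (Y h) (Phi h).
  move=> h0; split; first by apply/(mprk2_stagesE cons) => //; split=> //; exact: ZP.
  apply/(mprk_updateE cons); [exact: pos_nneg|exact/pos_nneg/Z0|exact: PhiP].
have := ord pdC step ltr01 ysol y0 => /isO_bigO.
by apply: isO_eq => h _; rewrite add0r.
Qed.

(** A constant production matrix has an affine exact solution, so the step is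
    known to third order and the ratios balance the fluxes to second order. *)
Lemma constant_step (P : 'I_N -> 'I_N -> R) (Z : R -> 'rV[R]_N) :
  (forall i j, 0 <= P i j) -> (forall i, P i i = 0) -> stage2 P Z ->
  exists Phi : R -> 'rV[R]_N,
    (forall k, isO 3 (fun h => Phi h 0 k - (yn 0 k + h * flux P (fun=> 1) k)))
    /\ forall k, isO 2 (fun h => flux P (fun i => Phi h 0 i / sigmaZ Z h 0 i) k
                                - flux P (fun=> 1) k).
Proof.
move=> P0 Pd ZP.
pose p := affine_production P (fun _ _ => 0).
pose d := affine_destruction P (fun _ _ => 0).
have pdC : pds_class 3 p d by apply: affine_class.
have pE i j y : p i j y = P i j by rewrite /p /affine_production mul0r addr0.
have [|Phi [PhiP PhiO]] := @order_step p d Z pdC.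
  move=> h h0 k; rewrite (ZP h h0 k); congr (_ + _ * _).
  by apply: eq_flux => // i j; rewrite pE.
pose v : 'rV[R]_N := \row_k flux P (fun=> 1) k.
have ysol : ode_solution (pds_rhs p d) 0 1 (fun t => yn + t *: v).
  apply: (@ode_solution_along _ _ _ id (fun=> 1)) => t.
  apply/rowP => k; rewrite affine_rhsE !mxE mul1r.
  by apply: eq_flux => // i j; rewrite mul0r addr0.
have H k : isO 3 (fun h => Phi h 0 k - (yn 0 k + h * flux P (fun=> 1) k)).
  have := PhiO _ ysol; rewrite scale0r addr0 => /(_ erefl) /isO_rVP/(_ k).
  by apply: isO_eq => h _; rewrite !mxE.
exists Phi; split=> // k; apply: isO_divh; apply: isO_eq (H k) => h h0.
rewrite (PhiP h h0 k) (@eq_flux _ _ _ P _ (fun i => Phi h 0 i / sigmaZ Z h 0 i))//.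
  by ring.
by move=> i j; rewrite !pE -mulrDl b1 mul1r.
Qed.

(** Component [k] receives its mass from [j] alone, so its balance is an equation
    for the ratio at [j]. *)
Lemma transfer_step (k j : 'I_N) (m : R) (Z : R -> 'rV[R]_N) :
  k != j -> 0 < m -> stage2 (transfer k j m) Z ->
  exists Phi : R -> 'rV[R]_N,
    isO 3 (fun h => Phi h 0 j - (yn 0 j - h * m)) /\
    isO 2 (fun h => Phi h 0 j / sigmaZ Z h 0 j - 1).
Proof.
move=> kj m0 ZP.
have [i l|i|Phi [H1 H2]] := @constant_step (transfer k j m) Z _ _ ZP.
- by apply: transfer_ge0; exact: ltW.
- exact: transfer_diag.
exists Phi; split.
  apply: isO_eq (H1 j) => h _.
  by rewrite flux_transfer eqxx [j == k]eq_sym (negPf kj) /=; ring.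
apply: isO_eq (isOMl m^-1 (H2 k)) => h _.
rewrite !flux_transfer eqxx (negPf kj) /=; move: (_ / _) => q.
by field; exact: lt0r_neq0.
Qed.

Lemma sigma_coord_isO0 (Z : R -> 'rV[R]_N) i :
  isO 1 (fun h => Z h - yn) -> isO 0 (fun h => sigmaZ Z h 0 i).
Proof.
move=> Z1; apply: (@cvg_isO0 _ _ _ (sigma (yn, yn, yn) 0 i)).
apply: (@cvg_comp _ _ _ _ (fun s : 'rV[R]_N => s 0 i) _ _ _ (sigma_cvg hpwd yn0 Z1)).
exact: coord_continuous.
Qed.

Lemma sigma_of_ratio q (Z Phi : R -> 'rV[R]_N) i :
  (forall h, 0 < h -> pos_orthant (Z h)) -> isO 1 (fun h => Z h - yn) ->
  isO q (fun h => Phi h 0 i / sigmaZ Z h 0 i - 1) ->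
  isO q (fun h => sigmaZ Z h 0 i - Phi h 0 i).
Proof.
move=> Z0 Z1 r1; have := isON (isOM r1 (sigma_coord_isO0 i Z1)); rewrite addn0.
apply: isO_eq => h h0; rewrite mulrBl mul1r divfK ?opprB// gt_eqF//.
exact: (sigma_gt0 hpwd yn0 (Z0 h h0)).
Qed.

Hypothesis N2 : (1 < N)%N.

Lemma other_index (j : 'I_N) : exists k, k != j.
Proof.
have N0 : (0 < N)%N by exact: ltn_trans N2.
have [j0|j0] := eqVneq (val j) 0%N.
  by exists (Ordinal N2); rewrite -val_eqE /= j0.
by exists (Ordinal N0); rewrite -val_eqE /= eq_sym.
Qed.

(** The donor [j] of a transfer has ratio [1 + O(h^2)], while both its numerator
    and its denominator converge. *)
Lemma sigma_base : sigma (yn, yn, yn) = yn.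
Proof.
apply/rowP => j; have [k kj] := other_index j.
have m0 : 0 < 1 :> R := ltr01.
have t0 i l : 0 <= transfer k j 1 i l :> R by apply: transfer_ge0; exact: ltW.
have [Z ZP] := stage2_exists t0.
have Z0 := stage2_gt0 a0 hpwd yn0 t0 ZP; have Z1 := stage2_isO1 a0 hpwd yn0 t0 ZP.
have [Phi [H1 H2]] := transfer_step kj m0 ZP.
have s1 : isO 1 (fun h => sigmaZ Z h 0 j - yn 0 j).
  have s2 := isOW (isT : 1 <= 2)%N (sigma_of_ratio Z0 Z1 H2).
  have h1 : isO 1 (fun h : R => - (h * 1)) by apply/isON/isO_hM/isO_cst.
  apply: isO_eq (isOD (isOD s2 (isOW (isT : 1 <= 3)%N H1)) h1) => h _.
  by ring.
have l1 : sigmaZ Z h 0 j @[h --> 0^'+] --> yn 0 j.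
  by apply/subr_cvg0; exact: isO_cvg0 s1.
have l2 : sigmaZ Z h 0 j @[h --> 0^'+] --> sigma (yn, yn, yn) 0 j.
  apply: (@cvg_comp _ _ _ _ (fun s : 'rV[R]_N => s 0 j) _ _ _ (sigma_cvg hpwd yn0 Z1)).
  exact: coord_continuous.
exact: (cvg_unique _ l2 l1).
Qed.

(** The production [p_kj(y) = y_j] has the same second stage as the constant
    production with the value [yn_j], hence the same denominators; the two exact
    solutions agree to second order, so the ratio is [1 + O(h^2)] in both cases.
    The second-order term of the exact solution then fixes the stage. *)
Lemma pi2_base : pi2 (yn, yn) = yn.
Proof.
apply/rowP => j; have [k kj] := other_index j.
pose B := transfer k j (1 : R); pose m := yn 0 j.
have m0 : 0 < m := yn0 j.
pose p := affine_production (fun _ _ => 0) B.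
pose d := affine_destruction (fun _ _ => 0) B.
have B0 i l : 0 <= B i l by exact: transfer_ge0.
have Bd i : B i i = 0 by exact: transfer_diag.
have pdC : pds_class 3 p d by apply: affine_class.
have pE i l y : p i l y = transfer k j (y 0 j) i l.
  rewrite /p /affine_production /B /transfer add0r.
  by have [->|] := eqVneq l j; rewrite ?andbT ?andbF ?mulr0 ?mul0r//; ring.
have t0 i l : 0 <= transfer k j m i l by apply: transfer_ge0; exact: ltW.
have [Z ZP] := stage2_exists t0.
have Z0 := stage2_gt0 a0 hpwd yn0 t0 ZP; have Z1 := stage2_isO1 a0 hpwd yn0 t0 ZP.
have [Phic [Hc1 Hc2]] := transfer_step kj m0 ZP.
have [|Phi [PhiP PhiO]] := @order_step p d Z pdC.
  move=> h h0 i; rewrite (ZP h h0 i); congr (_ + _ * _).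
  by apply: eq_flux => // i' l; rewrite pE.
pose s i : R := (i == k)%:R - (i == j)%:R.
have sj : s j = - 1 by rewrite /s eqxx eq_sym (negPf kj) sub0r.
have sk : s k = 1 by rewrite /s eqxx (negPf kj) subr0.
have fE y i : pds_rhs p d y 0 i = y 0 j * s i.
  rewrite affine_rhsE (@eq_flux _ _ _ (transfer k j (y 0 j)) _ (fun=> 1))//.
    by rewrite flux_transfer mulr1.
  by move=> i' l; rewrite -pE.
pose v : 'rV[R]_N := \row_i (m * s i).
have ysol : ode_solution (pds_rhs p d) 0 1 (fun t => yn + (1 - expR (- t)) *: v).
  apply: (@ode_solution_along _ _ _ (fun t => 1 - expR (- t)) (fun t => expR (- t))) => t.
    have -> : (fun t => 1 - expR (- t)) = cst 1 - (expR \o -%R) by [].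
    apply: is_derive_eq; rewrite ?fctE /= sub0r.
    by rewrite mulrN1 opprK.
  by apply/rowP => i; rewrite fE !mxE sj -/m; ring.
have fJ i : taylor1 (fun y => pds_rhs p d y 0 i) yn (fun l => s i * (l == j)%:R).
  exists 0; near=> z; rewrite mul0r normr_le0 !fE.
  rewrite (bigD1 j)//= eqxx big1 => [|l /negPf ->]; last by rewrite mulr0 mul0r.
  by rewrite /= mulr1 addr0; apply/eqP; ring.
have y0E : yn + (1 - expR (- 0)) *: v = yn by rewrite oppr0 expR0 subrr scale0r addr0.
have yT i : isO 3 (fun h => Phi h 0 i - (yn 0 i + h * (m * s i) - h ^+ 2 / 2 * (m * s i))).
  have Jf : \sum_l s i * (l == j)%:R * (m * s l) = - (m * s i).
    rewrite (bigD1 j)//= eqxx big1 => [|l /negPf ->]; last by rewrite mulr0 mul0r.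
    by rewrite sj /= mulr1 addr0; ring.
  have yE := ode_taylor2 (J := fun i l => s i * (l == j)%:R) ltr01 ysol.
  rewrite /= y0E in yE.
  have /(_ i) O2 := yE fJ; have /isO_rVP/(_ i) O1 := PhiO _ ysol y0E.
  apply: isO_eq (isOD O1 O2) => h _.
  under eq_bigr do rewrite fE -/m; rewrite Jf fE -/m !mxE add0r.
  by field.
have r1 : isO 2 (fun h => Phi h 0 j / sigmaZ Z h 0 j - 1).
  have Pd : isO 2 (fun h => Phi h 0 j - Phic h 0 j).
    have h2 : isO 2 (fun h : R => h ^+ 2 / 2 * m).
      by apply: isO_eq (isO_hM (isO_hM (isO_cst (m / 2)))) => h _; field.
    apply: isO_eq (isOD (isOB (isOW (isT : 2 <= 3)%N (yT j)) (isOW (isT : 2 <= 3)%N Hc1)) h2) => h _.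
    by rewrite sj /m; field.
  have := isOM Pd (sigma_inv_isO0 hpwd yn0 j Z1); rewrite addn0 => /isOD/(_ Hc2).
  by apply: isO_eq => h _; ring.
(* The production at the update is the [b]-weighted mean of the values at the two
   stages; its expansion is read off from component [k]. *)
pose mu h := b 0 0 * m + b 0 1 * Z h 0 j.
have Zj1 : isO 1 (fun h => Z h 0 j - m).
  by have /isO_rVP/(_ j) := Z1; apply: isO_eq => h _; rewrite !mxE.
have mu0 : isO 0 mu.
  apply: isOD (isO_cst _) _; apply: isOMl.
  apply: isO_eq (isOD (isOW (isT : 0 <= 1)%N Zj1) (isO_cst m)) => h _.
  by rewrite subrK.
have mu2 : isO 2 (fun h => mu h - m + h / 2 * m).
  have E : isO 3 (fun h => h * (mu h * (Phi h 0 j / sigmaZ Z h 0 j) - m + h / 2 * m)).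
    apply: isO_eq (yT k) => h h0; rewrite (PhiP h h0 k).
    rewrite (@eq_flux _ _ _ (transfer k j (mu h)) _ (fun i => Phi h 0 i / sigmaZ Z h 0 i))//.
      by rewrite flux_transfer -/(s k) sk; move: (Phi h 0 j / _) => q; field.
    by move=> i l; rewrite !pE /transfer /mu -/m; ring.
  apply: isO_eq (isOB (isO_divh E) (isOM mu0 r1)) => h _.
  by move: (_ / sigma _ _ _) => q; ring.
have : isO 1 (fun h => 1 - Z h 0 j / pi2 (yn, yn) 0 j).
  apply: isO_divh; apply: isO_eq (isOMl (2 / m) mu2) => h h0.
  set q := _ / pi2 (yn, yn) 0 j.
  have ZE : Z h 0 j = m - h * (A 1 0 * (m * q)).
    rewrite (ZP h h0 j) fluxZl flux_transfer -/(s j) sj -/m -/q; ring.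
  have -> : mu h - m + h / 2 * m = (b 0 0 + b 0 1) * m
      - b 0 1 * A 1 0 * (h * m * q) - m + h / 2 * m.
    by rewrite /mu ZE; ring.
  by rewrite b1 ba; field; exact: lt0r_neq0.
have pij : pi2 (yn, yn) 0 j != 0 by rewrite gt_eqF// (pi2_gt0 hpwd).
move=> /(isOMl (pi2 (yn, yn) 0 j)) Q.
apply/eqP; rewrite -subr_eq0; apply/eqP; apply: (@isO_cst_eq0 R 0).
apply: isO_eq (isOD Q Zj1) => h _.
by rewrite -/m; field.
Unshelve. all: by end_near. Qed.

(** The mixing matrix [yn_i yn_j], without its diagonal, acts on ratios as
    subtraction from their weighted mean: it annihilates constants, and its
    kernel consists of the constants. *)
Lemma mixing_flux (x : 'I_N -> R) k :
  flux (fun i j => (i != j)%:R * (yn 0 i * yn 0 j)) x k =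
  yn 0 k * (\sum_i yn 0 i * x i) - yn 0 k * x k * \sum_i yn 0 i.
Proof.
rewrite !mulr_sumr -sumrB; apply: eq_bigr => nu _.
by have [->|nk] := eqVneq k nu; rewrite /= ?[nu == k]eq_sym ?eqxx ?(negPf nk) /=; ring.
Qed.

(** When [flux P 1] does not vanish, the constant problem is compared with the one
    to which a multiple of the mixing matrix is added. *)
Lemma pwd_necessary (p d : 'I_N -> 'I_N -> 'rV[R]_N -> R) :
  pds_class 3 p d -> pwd_conditions A pi1 pi2 sigma p d yn.
Proof.
move=> pdC Y st; have cons : conservative_pds p d by case: pdC.
pose P i j := p i j yn; pose Z h := Y h 1.
have P0 i j : 0 <= P i j by case: (cons _ (pos_nneg yn0) i j).
have Pd i : P i i = 0 by case: (cons _ (pos_nneg yn0) i i).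
have {}st h (h0 : 0 < h) := (mprk2_stagesE cons A pi1 pi2 yn0 h (Y h)).1 (st h h0).
have Y0 h : 0 < h -> Y h 0 = yn by move=> h0; case: (st h h0).
have ZP : stage2 P Z by move=> h h0; case: (st h h0).
have Z0 := stage2_gt0 a0 hpwd yn0 P0 ZP; have Z1 := stage2_isO1 a0 hpwd yn0 P0 ZP.
pose f k := pds_rhs p d yn 0 k.
have fE k : f k = flux P (fun=> 1) k by apply: pds_rhsE => //; exact: pos_nneg.
split=> [nu|mu].
  apply/(isO_bigO 1); apply: isO_eq (isO0 _ 1) => h h0.
  by rewrite Y0// pi2_base subrr.
apply/isO_bigO.
suff : isO 2 (fun h => sigmaZ Z h 0 mu - (yn 0 mu + h * f mu)).
  by apply: isO_eq => h h0; rewrite Y0.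
have [f0|] := pselect (forall k, f k = 0).
  apply: isO_eq (isO0 _ 2) => h h0.
  have ZE : Z h = yn.
    apply: (patankar_sys_uniq (ltW h0) _ (pi2_gt0 hpwd yn0) (ZP h h0)).
      by move=> i j; exact: mulr_ge0.
    move=> k; rewrite (@eq_flux _ _ _ (fun i j => A 1 0 * P i j) _ (fun=> 1))//.
      by rewrite fluxZl -fE f0 !mulr0 addr0.
    by move=> i; rewrite pi2_base divff// gt_eqF.
  by rewrite ZE sigma_base f0 mulr0 addr0 subrr.
move=> /existsNP[k0 /eqP fk0].
have a_gt0 : 0 < A 1 0.
  rewrite lt_neqAle a0 andbT; apply/eqP => aE; move: ba; rewrite -aE mulr0 => /eqP.
  by rewrite eq_sym invr_eq0 pnatr_eq0.
pose S := \sum_i yn 0 i.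
have S0 : 0 < S.
  rewrite /S (bigD1 k0)//= ltr_wpDr// sumr_ge0// => i _; exact/ltW/yn0.
(* This weight makes the change of parameter exactly [h' = h / (1 - h)]. *)
pose kap := (A 1 0 * S)^-1.
have kap0 : 0 < kap by rewrite invr_gt0 mulr_gt0.
pose P' i j := P i j + kap * ((i != j)%:R * (yn 0 i * yn 0 j)).
have P'0 i j : 0 <= P' i j.
  rewrite addr_ge0// mulr_ge0 ?(ltW kap0)// mulr_ge0//.
  by rewrite mulr_ge0// ltW.
have P'd i : P' i i = 0 by rewrite /P' Pd eqxx mul0r mulr0 addr0.
have P'E x k : flux P' x k = flux P x k +
    kap * (yn 0 k * (\sum_i yn 0 i * x i) - yn 0 k * x k * S).
  by rewrite fluxDl fluxZl mixing_flux.
(* On the stage curve mixing is proportional to [Z - yn], because the total mass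
   of [Z] is [S]; so it only rescales the step size. *)
pose Z' h := Z (h / (1 + h)).
have Z'P : stage2 P' Z'.
  move=> h h0 k; have h1 : 0 < 1 + h by rewrite addr_gt0.
  have hh : 0 < h / (1 + h) by rewrite divr_gt0.
  have aP0 i j : 0 <= A 1 0 * P i j by exact: mulr_ge0.
  rewrite fluxZl P'E pi2_base.
  have -> : \sum_i yn 0 i * (Z' h 0 i / yn 0 i) = S.
    rewrite /S -(patankar_sys_sum (ZP _ hh)); apply: eq_bigr => i _.
    by rewrite mulrC divfK// gt_eqF.
  have := ZP _ hh k; rewrite -/(Z' h) fluxZl pi2_base.
  move: (flux _ _ _) => F ZE.
  have FE : F = (Z' h 0 k - yn 0 k) * (1 + h) / (h * A 1 0).
    by rewrite ZE; field; rewrite !gt_eqF.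
  rewrite FE /kap; field; rewrite !gt_eqF//.
have Z'Z h : 0 < h -> h < 1 -> Z' (h / (1 - h)) = Z h.
  move=> h0 h1; rewrite /Z'; congr Z; field.
  by rewrite gt_eqF ?subr_gt0//= subrK oner_eq0.
have [Phi [H1 H2]] := constant_step P0 Pd ZP.
have [Phi' [H1' H2']] := constant_step P'0 P'd Z'P.
pose r h i := Phi h 0 i / sigmaZ Z h 0 i.
have near1 : \forall h \near 0^'+, 0 < h /\ h < (1 : R).
  by apply/near_right0P; exists 1.
(* Both steps at the same stage, hence with the same denominators. *)
pose r' h i := Phi' (h / (1 - h)) 0 i / sigmaZ Z h 0 i.
have f'E k : flux P' (fun=> 1) k = f k.
  rewrite P'E fE; under eq_bigr do rewrite mulr1.
  by rewrite -/S mulr1 subrr mulr0 addr0.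
have Phi2 i : isO 2 (fun h => Phi' (h / (1 - h)) 0 i - Phi h 0 i).
  have T : isO 2 (fun h : R => h / (1 - h) * h * f i).
    have hr := isO_reparam (@isO_id R).
    by have := isOM (isOM hr (@isO_id R)) (isO_cst (f i)).
  have := isOD (isOB (isO_reparam (isOW (isT : 2 <= 3)%N (H1' i)))
                     (isOW (isT : 2 <= 3)%N (H1 i))) T.
  apply: isO_eq_near; near=> h.
  have [h0 h1] : 0 < h /\ h < 1 by near: h.
  by rewrite f'E -fE; field; rewrite subr_eq0 gt_eqF.
have r2 i : isO 2 (fun h => r' h i - r h i).
  have := isOM (Phi2 i) (sigma_inv_isO0 hpwd yn0 i Z1); rewrite addn0.
  by apply: isO_eq => h _; rewrite mulrBl.
have L1 k : isO 2 (fun h => flux P (r h) k - f k).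
  by apply: isO_eq (H2 k) => h _; rewrite fE.
have L2 k : isO 2 (fun h => flux P' (r h) k - f k).
  have := isOB (isO_reparam (H2' k)) (isO_fluxr P' k r2).
  apply: isO_eq_near; near=> h.
  have [h0 h1] : 0 < h /\ h < 1 by near: h.
  by rewrite f'E fluxBr Z'Z// /r' opprB; ring.
pose c h := (\sum_i yn 0 i * r h i) / S.
(* The difference of the two balances is the mixing flux of [r]. *)
have rc i : isO 2 (fun h => r h i - c h).
  have := isOMl (- A 1 0 / yn 0 i) (isOB (L2 i) (L1 i)).
  apply: isO_eq => h h0; rewrite P'E /kap /c -/(r h i).
  move: (flux _ _ _) (\sum_i _) (r h i) => F s ri.
  by field; rewrite !gt_eqF.
have c1 : isO 2 (fun h => c h - 1).
  have := isOMl (f k0)^-1 (isOB (L1 k0) (isO_fluxr P k0 rc)).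
  apply: isO_eq => h _; rewrite fluxBr.
  have -> : flux P (fun=> c h) k0 = c h * f k0.
    by rewrite fE -fluxZr; apply: eq_flux => // i; rewrite mulr1.
  by move: (c h) (flux _ _ _) => ch F; field.
have r1 : isO 2 (fun h => Phi h 0 mu / sigmaZ Z h 0 mu - 1).
  by apply: isO_eq (isOD (rc mu) c1) => h _; rewrite /r addrA subrK.
have sP := sigma_of_ratio Z0 Z1 r1.
apply: isO_eq (isOD sP (isOW (isT : 2 <= 3)%N (H1 mu))) => h _.
by rewrite fE addrA subrK.
Unshelve. all: by end_near. Qed.

End Necessity.

Theorem theorem4p12 (R : realType) (A : 'M[R]_2) (b c : 'rV[R]_2)
    (hA : forall i j, 0 <= A i j) (hb : forall j, 0 <= b 0 j)
    (hc : forall i, \sum_j A i j = c 0 i)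
    (hexpl : rk_explicit A) (hord : rk_order A b 2)
    (N : nat)
    (pi1 : 'rV[R]_N -> 'rV[R]_N)
    (pi2 : 'rV[R]_N * 'rV[R]_N -> 'rV[R]_N)
    (sigma : 'rV[R]_N * 'rV[R]_N * 'rV[R]_N -> 'rV[R]_N)
    (hpwd : admissible_pwd pi1 pi2 sigma) :
  (forall (p d : 'I_N -> 'I_N -> 'rV[R]_N -> R) (yn : 'rV[R]_N),
     pds_class 3 p d -> pos_orthant yn ->
     pwd_conditions A pi1 pi2 sigma p d yn ->
     mprk2_order A b pi1 pi2 sigma p d yn 2) /\
  ((1 < N)%N ->
   (forall (p d : 'I_N -> 'I_N -> 'rV[R]_N -> R) (yn : 'rV[R]_N),
      pds_class 3 p d -> pos_orthant yn ->
      mprk2_order A b pi1 pi2 sigma p d yn 2)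
   <->
   (forall (p d : 'I_N -> 'I_N -> 'rV[R]_N -> R) (yn : 'rV[R]_N),
      pds_class 3 p d -> pos_orthant yn ->
      pwd_conditions A pi1 pi2 sigma p d yn)).
Proof.
have [b1 ba] := rk2_order_conditions hexpl hord.
have a0 := hA 1 0.
have sufficient (p d : 'I_N -> 'I_N -> 'rV[R]_N -> R) (yn : 'rV[R]_N) :
    pds_class 3 p d -> pos_orthant yn ->
    pwd_conditions A pi1 pi2 sigma p d yn ->
    mprk2_order A b pi1 pi2 sigma p d yn 2.
  by move=> pdC yn0; apply: (mprk2_sufficient a0 hb hpwd yn0 b1 ba pdC).
split=> // N2; split=> H p d yn pdC yn0; last by apply: sufficient => //; exact: H.
apply: (pwd_necessary a0 hb b1 ba hpwd yn0) => // p' d' pdC'.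
exact: H.
Qed.
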